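(* Let $T$ be a maximal elliptic torus of $Sp(W)$, $W=W_1\oplus\cdots\oplus W_n$ the orthogonal decomposition of $W$ into $T$-submodules irreducible over $k$, $T_i$ the image of $T$ in $Sp(W_i)$, and identify $T=T_1\times\cdots\times T_n$. For each $i$ let $B_i$ be a $T_i$-invariant good lattice of $W_i$, and $B=B_1\oplus\cdots\oplus B_n$. With $T$ lifted to $Mp(W)$ by $s_B$ and $T_i$ lifted to $Mp(W_i)$ by $s_{B_i}$, the restriction of the Weil representation to $T$ is the external tensor product of the restrictions to the $T_i$ of the Weil representations of the $Mp(W_i)$: $$(S_{W,\psi})_{|T}=\bigotimes_{i=1}^{n}(S_{W_i,\psi})_{|T_i}.$$
   Context: $k$ is a non-archimedean local field of characteristic $0$ with ring of integers $\mathcal{O}$, uniformizer $\varpi$, residue field $\mathbb{F}_q$ of characteristic $p\neq2$; $\psi$ is a non-trivial unitary character of $(k,+)$ with conductor $\lambda_\psi$ (trivial on $\varpi^{\lambda_\psi}\mathcal{O}$, not on $\varpi^{\lambda_\psi-1}\mathcal{O}$); $\overline\psi$ is the character of $\mathbb{F}_q$ with $\overline\psi(x\bmod\varpi)=\psi(\varpi^{\lambda_\psi-1}x)$. $(W,\beta)$ is a non-zero finite-dimensional symplectic $k$-space. A torus of $Sp(W)$ is elliptic if it is anisotropic (equivalently compact). For a maximal elliptic torus $T$, $W$ decomposes uniquely as an orthogonal direct sum of symplectic subspaces $W_i$ that are $T$-submodules irreducible over $k$; the image $T_i$ of $T$ under $x\mapsto x_{|W_i}$ is a maximal elliptic torus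 of $Sp(W_i)$, and $x\mapsto(x_{|W_i})_i$ is an isomorphism $T\cong\prod T_i$. **Lattices.** A lattice is a compact open $\mathcal{O}$-submodule; $B^*=\{v:\beta(v,b)\in\varpi^{\lambda_\psi}\mathcal{O}\ \forall b\in B\}$; $B$ is good if $\varpi B^*\subset B\subset B^*$, self-dual if $B=B^*$. $K_B$ is the stabilizer of $B$ in the symplectic group. **Weil representation.** $H(W)=W\times k$ with $(w,t)(w',t')=(w+w',t+t'+\frac12\beta(w,w'))$; $\rho_\psi$ its irreducible unitary representation of central character $\psi$ on $\mathcal{H}$; $Mp(W)$ is the unique subgroup of $\{(g,U)\in Sp(W)\times U(\mathcal{H}):U\rho_\psi(w,t)U^{-1}=\rho_\psi(gw,t)\}$ projecting onto $Sp(W)$ with kernel of order $2$; the Weil representation $S_{W,\psi}$ is $(g,U)\mapsto U$ (and likewise for $W_i$). **The section $s_B:K_B\to Mp(W)$.** Let $A$ be a self-dual lattice with $B\subset A\subset B^*$. $\mathrm{b}^*=B^*/B$ has the $\mathbb{F}_q$-symplectic form $\varpi^{1-\lambda_\psi}\beta\bmod\varpi$ and dimension $2l$; $\mathrm{x}=A/B$ is a Lagrangian; for $g\in K_B$ let $\bar g$ be its image in $Sp(\mathrm{b}^* )$. Put $j(h)=l-\dim(\mathrm{x}\cap h\mathrm{x})$ for $h\in Sp(\mathrm b^* )$, $\omega(a)=q^{-1/2}\sum_{t\in\mathbb{F}_q}\overline\psi(\frac12at^2)$, and let $\theta:Sp(\mathrm{b}^* )\to\mathbb{F}_q^\times/(\mathbb{F}_q^\times)^2$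 be the function with $\theta(p_1hp_2)=\theta(p_1)\theta(h)\theta(p_2)$ for $p_1,p_2$ in the stabilizer $P$ of $\mathrm{x}$, $\theta(p)=\det(p_{|\mathrm{x}})$ for $p\in P$, and $\theta(\tau_S)=1$ for $S\subset\{1,\dots,l\}$, where, for a symplectic basis $(\epsilon_i,\phi_i)$ with the $\epsilon_i$ spanning $\mathrm{x}$, $\tau_S\epsilon_i=\phi_i$, $\tau_S\phi_i=-\epsilon_i$ for $i\in S$ and $\tau_S$ fixes the other basis vectors. Put $m(h)=\omega(\theta(h))^{-1}\omega(1)^{1-j(h)}$. On the space $\mathcal{H}^A_\psi$ of functions $\varphi:W\to\mathbb{C}$ with $\varphi(a+w)=\psi(\frac12\beta(w,a))\varphi(w)$ ($a\in A$), $\int_{W/A}|\varphi|^2<\infty$, $H(W)$ acts by $\rho_\psi^A(w,t)\varphi(w')=\psi(t+\frac12\beta(w',w))\varphi(w'+w)$ (a model of $\rho_\psi$), and $s_B(g)=(g,S^A_\psi(g))$ with $$S^A_\psi(g)\varphi(w)=m(\bar g)q^{j(\bar g)/2}[A:A\cap gA]^{-1}\sum_{a\in A/(A\cap gA)}\psi(\tfrac12\beta(a,w))\varphi(g^{-1}(a+w)),\quad g\in K_B.$$ This is a homomorphism into $Mp(W)$ lifting $K_B$, and, under the canonical identification of the different models, is independent of $A$. The sections $s_{B_i}:K_{B_i}\to Mp(W_i)$ are defined in the same way. *)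

(* Defs.v *)
From HB Require Import structures.
From mathcomp Require Import all_boot all_order all_algebra all_field.
From mathcomp Require Import finmap.
From mathcomp.real_closed Require Import complex.
From mathcomp Require Import all_classical all_reals all_analysis.

Set Implicit Arguments.
Unset Strict Implicit.
Unset Printing Implicit Defensive.

Import Order.TTheory GRing.Theory Num.Theory.
Import numFieldNormedType.Exports.

Local Open Scope classical_set_scope.
Local Open Scope ring_scope.
Local Open Scope complex_scope.

(* The value of [vval] at 0 is junk: "vval x >= n" is always written with the
   alternative "x = 0". *)
HB.mixin Record isNALocalField K & GRing.Field K & Topological K := {
  vval : K -> int;
  vvalM : forall x y : K, x != 0 -> y != 0 -> vval (x * y) = vval x + vval y;
  vvalD : forall x y : K, x != 0 -> y != 0 -> x + y != 0 ->
    Num.min (vval x) (vval y) <= vval (x + y);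
  vval_normalized : exists2 x : K, x != 0 & vval x = 1;
  nbhs_vvalE : forall (x : K) (U : set K),
    nbhs x U <-> exists N : int,
      forall y, (y - x == 0) || (N <= vval (y - x)) -> U y;
  vval_complete : forall u : nat -> K,
    (forall N : int, exists i0 : nat, forall i j : nat,
       (i0 <= i)%N -> (i0 <= j)%N ->
       (u i - u j == 0) || (N <= vval (u i - u j))) ->
    exists l : K, u @ \oo --> l;
  residue_field : finFieldType;
  residue : K -> residue_field;
  residue1 : residue 1 = 1;
  residueD : forall x y : K, (x == 0) || (0 <= vval x) ->
    (y == 0) || (0 <= vval y) -> residue (x + y) = residue x + residue y;
  residueM : forall x y : K, (x == 0) || (0 <= vval x) ->
    (y == 0) || (0 <= vval y) -> residue (x * y) = residue x * residue y;
  residue_surj : forall a : residue_field,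
    exists2 x : K, (x == 0) || (0 <= vval x) & residue x = a;
  residue_ker : forall x : K, (x == 0) || (0 <= vval x) ->
    (residue x = 0 <-> (x == 0) || (0 < vval x))
}.

#[short(type="naLocalFieldType")]
HB.structure Definition NALocalField :=
  {K of GRing.Field K & Topological K & isNALocalField K}.

Notation resf k := (@residue_field k).

Section LocalField.
Variable k : naLocalFieldType.

(* varpi ^ N * O, for any uniformizer varpi *)
Definition pideal (N : int) : set k := [set x | (x == 0) || (N <= vval x)].

Definition integers : set k := pideal 0.

Definition uniformizer (varpi : k) := varpi != 0 /\ vval varpi = 1.

End LocalField.

Section Characters.
Variables (R : realType) (k : naLocalFieldType).
Local Notation C := R[i].

Definition unitary_character (psi : k -> C) :=
  [/\ forall x y, psi (x + y) = psi x * psi y,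
      forall x, `|psi x| = 1 &
      forall e : R, 0 < e -> \forall x \near (0 : k), `|psi x - 1| < e%:C].

Definition has_conductor (psi : k -> C) (lam : int) :=
  (forall x, pideal lam x -> psi x = 1) /\
  (exists2 x, pideal (lam - 1) x & psi x != 1).

(* The value does not depend on the lift of [a] to O when [lam] is the
   conductor of [psi]. *)
Definition psibar (varpi : k) (psi : k -> C) (lam : int) (a : resf k) : C :=
  psi (varpi ^ (lam - 1) * xget 0 [set x : k | integers x /\ residue x = a]).

Definition sqrtq : C := (Num.sqrt (#|resf k|%:R : R))%:C.

Definition omega (varpi : k) (psi : k -> C) (lam : int) (a : resf k) : C :=
  sqrtq^-1 * \sum_(t : resf k) psibar varpi psi lam (2%:R^-1 * a * t ^+ 2).

End Characters.

Section SymplecticSpaces.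
Variables (K : fieldType) (W : vectType K).
Implicit Types (beta : W -> W -> K) (g : 'End(W)) (U : {vspace W}).

Definition symplectic_form beta :=
  [/\ forall a u v w, beta (a *: u + v) w = a * beta u w + beta v w,
      forall a u v w, beta w (a *: u + v) = a * beta w u + beta w v,
      forall v, beta v v = 0 &
      forall v, (forall w, beta v w = 0) -> v = 0].

(* Sp(W) as a set of endomorphisms: an isometry of a symplectic form is
   invertible. *)
Definition Sp beta : set 'End(W) :=
  [set g | forall v w, beta (g v) (g w) = beta v w].

Definition stable_sub U g := (g @: U <= U)%VS.

(* matrix of g on a g-stable subspace, in the basis [vbasis U] *)
Definition mx_on U g : 'M[K]_(\dim U) :=
  \matrix_(i, j) coord (vbasis U) j (g (vbasis U)`_i).

Definition restr_form beta U (u v : subvs_of U) : K := beta (vsval u) (vsval v).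

Definition restr_end U g : 'End(subvs_of U) :=
  linfun (fun u : subvs_of U => vsproj U (g (vsval u))).

End SymplecticSpaces.

Arguments restr_form {K W} beta U u v.

(* Tori are given by their groups of K-points.  K being infinite and perfect in
   the application, a K-torus has a Zariski dense set of K-points, so that these
   points determine the torus, and the properties below (Zariski-closed,
   connected, diagonalizable over a finite extension of K) and the K-rational
   characters can be read on them.  As det = 1 on the symplectic group, its
   regular functions are the polynomials in the matrix entries. *)
Section Tori.
Variables (K : fieldType) (W : vectType K).
Implicit Types (T Z : set 'End(W)) (beta : W -> W -> K).

Inductive regular_fun : ('End(W) -> K) -> Prop :=
| regular_const c : regular_fun (fun=> c)
| regular_entry i j : regular_fun (fun g => mx_on fullv g i j)
| regular_add f h :
    regular_fun f -> regular_fun h -> regular_fun (fun g => f g + h g)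
| regular_mul f h :
    regular_fun f -> regular_fun h -> regular_fun (fun g => f g * h g).

Definition zariski_closed Z :=
  exists2 I : set ('End(W) -> K), I `<=` regular_fun &
    Z = [set g | forall f, I f -> f g = 0].

Definition zariski_connected T :=
  forall Z1 Z2, zariski_closed Z1 -> zariski_closed Z2 ->
    T `<=` Z1 `|` Z2 -> T `&` Z1 `&` Z2 = set0 -> T `<=` Z1 \/ T `<=` Z2.

Definition split_by_extension T :=
  exists (L : fieldExtType K) (P : 'M[L]_(\dim (@fullv K W))),
    P \in unitmx /\
    forall g, T g ->
      is_diag_mx (P *m map_mx (in_alg L) (mx_on fullv g) *m invmx P).

Definition torus beta T :=
  [/\ T `<=` Sp beta,
      [/\ T \1%VF,
          forall g h, T g -> T h -> T (g \o h)%VF &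
          forall g, T g -> T (g^-1)%VF],
      zariski_closed T, zariski_connected T & split_by_extension T].

Definition maximal_torus beta T :=
  torus beta T /\ forall T', torus beta T' -> T `<=` T' -> T' = T.

(* no non-trivial character defined over K *)
Definition anisotropic T :=
  forall chi, regular_fun chi -> chi \1%VF = 1 ->
    (forall g h, T g -> T h -> chi (g \o h)%VF = chi g * chi h) ->
    forall g, T g -> chi g = 1.

Definition maximal_elliptic_torus beta T := maximal_torus beta T /\ anisotropic T.

Definition irreducible_submodule T (U : {vspace W}) :=
  [/\ U != 0%VS, forall g, T g -> stable_sub U g &
      forall U' : {vspace W}, (U' <= U)%VS ->
        (forall g, T g -> stable_sub U' g) -> U' = 0%VS \/ U' = U].

Definition irreducible_decomposition beta T n (Wi : 'I_n -> {vspace W}) :=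
  [/\ (\sum_(i < n) Wi i)%VS = fullv,
      directv (\sum_(i < n) Wi i),
      forall i j u v, i != j -> u \in Wi i -> v \in Wi j -> beta u v = 0,
      forall i, symplectic_form (restr_form beta (Wi i)) &
      forall i, irreducible_submodule T (Wi i)].

End Tori.

Section Lattices.
Variables (k : naLocalFieldType) (W : vectType k).
Variables (beta : W -> W -> k) (varpi : k) (lam : int).
Implicit Types (A B L M : set W).

(* W carries the topology of k^n, through the coordinates in any basis. *)
Definition vcoords (w : W) : 'rV[k]_(\dim (@fullv k W)) :=
  \row_i coord (vbasis fullv) i w.

Definition of_coords (r : 'rV[k]_(\dim (@fullv k W))) : W :=
  \sum_i r 0 i *: (vbasis (@fullv k W))`_i.

Definition lattice L :=
  [/\ L 0,
      forall u v, L u -> L v -> L (u + v),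
      forall a u, integers a -> L u -> L (a *: u),
      open (vcoords @` L) &
      compact (vcoords @` L)].

Definition dual_lattice B : set W :=
  [set v | forall b, B b -> pideal lam (beta v b)].

Definition good_lattice B :=
  [/\ lattice B, [set varpi *: v | v in dual_lattice B] `<=` B &
      B `<=` dual_lattice B].

Definition self_dual_lattice A := lattice A /\ A = dual_lattice A.

Definition stabilizer B : set 'End(W) :=
  [set g | Sp beta g /\ [set g b | b in B] = B].

(* M / L, as the set of the cosets x + L, x in M; a coset c has the
   representative [xget 0 c]. *)
Definition cosets M L : set (set W) := [set [set x + y | y in L] | x in M].

(* b^* = B^* / B with its symplectic form and the action of K_B; [red_proj] is
   meaningful on B^* only. *)
Record reduction B := Reduction {
  red_space : vectType (resf k);
  red_proj : W -> red_space;
  red_projD : forall u v, dual_lattice B u -> dual_lattice B v ->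
    red_proj (u + v) = red_proj u + red_proj v;
  red_projZ : forall a u, integers a -> dual_lattice B u ->
    red_proj (a *: u) = residue a *: red_proj u;
  red_proj_surj : forall x, exists2 u, dual_lattice B u & red_proj u = x;
  red_proj_ker : forall u, dual_lattice B u -> (red_proj u = 0 <-> B u);
  red_form : red_space -> red_space -> resf k;
  red_formE : forall u v, dual_lattice B u -> dual_lattice B v ->
    red_form (red_proj u) (red_proj v) = residue (varpi ^ (1 - lam) * beta u v);
  red_end : 'End(W) -> 'End(red_space);
  red_endE : forall g u, stabilizer B g -> dual_lattice B u ->
    red_end g (red_proj u) = red_proj (g u)
}.

End Lattices.

(* The function theta, with values in F^* / (F^* )^2 represented by elements of
   F^*, and the integer j(h), for a Lagrangian X of a symplectic F-space. *)
Section Theta.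
Variables (F : fieldType) (V : vectType F) (b : V -> V -> F) (X : {vspace V}).

Definition half_dim := (\dim (@fullv F V))./2.

Definition jdim (h : 'End(V)) : nat := half_dim - \dim (X :&: h @: X)%VS.

Definition eq_mod_squares (x y : F) := exists2 c, c != 0 & x = c ^+ 2 * y.

Definition parabolic : set 'End(V) := [set p | Sp b p /\ (p @: X)%VS = X].

Definition adapted_symplectic_basis (eps phi : 'I_half_dim -> V) :=
  [/\ <<[seq eps i | i : 'I_half_dim]>>%VS = X,
      forall i j, b (eps i) (eps j) = 0,
      forall i j, b (phi i) (phi j) = 0 &
      forall i j, b (eps i) (phi j) = (i == j)%:R].

Definition is_tau eps phi (S : {set 'I_half_dim}) (tau : 'End(V)) :=
  forall i, tau (eps i) = (if i \in S then phi i else eps i) /\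
            tau (phi i) = (if i \in S then - eps i else phi i).

Definition is_theta (theta : 'End(V) -> F) :=
  [/\ forall h, Sp b h -> theta h != 0,
      forall p1 h p2, parabolic p1 -> Sp b h -> parabolic p2 ->
        eq_mod_squares (theta (p1 \o (h \o p2))%VF)
                       (theta p1 * theta h * theta p2),
      forall p, parabolic p -> eq_mod_squares (theta p) (\det (mx_on X p)) &
      forall eps phi S tau, adapted_symplectic_basis eps phi ->
        is_tau eps phi S tau -> eq_mod_squares (theta tau) 1].

End Theta.

(* Complex Hilbert spaces; [hdot] is linear in its first argument. *)
Record hilbert (R : realType) := Hilbert {
  hcarrier :> lmodType R[i];
  hdot : hcarrier -> hcarrier -> R[i];
  hdot_linear : forall a x y z, hdot (a *: x + y) z = a * hdot x z + hdot y z;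
  hdot_conj : forall x y, hdot y x = (hdot x y)^*;
  hdot_ge0 : forall x, 0 <= hdot x x;
  hdot_eq0 : forall x, hdot x x = 0 -> x = 0;
  hcomplete : forall u : nat -> hcarrier,
    (forall e : R, 0 < e -> exists N : nat, forall i j : nat,
       (N <= i)%N -> (N <= j)%N -> hdot (u i - u j) (u i - u j) < e%:C) ->
    exists l, forall e : R, 0 < e -> exists N : nat, forall i : nat,
       (N <= i)%N -> hdot (u i - l) (u i - l) < e%:C
}.

Section HilbertSpaces.
Variable R : realType.
Local Notation C := R[i].

Definition unitary_op (H : hilbert R) (U : H -> H) :=
  [/\ forall (a : C) x y, U (a *: x + y) = a *: U x + U y,
      forall x y, hdot (U x) (U y) = hdot x y &
      forall y, exists x, U x = y].

Definition closed_subspace (H : hilbert R) (E : set H) :=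
  [/\ E 0,
      forall (a : C) x y, E x -> E y -> E (a *: x + y) &
      forall x, (forall e : R, 0 < e ->
                   exists2 y, E y & hdot (x - y) (x - y) < e%:C) -> E x].

(* [tau] exhibits H as the (completed) Hilbert tensor product of the Hi, with
   tau (x_1, ..., x_n) as the elementary tensor; this determines (H, tau) up to
   a unique unitary isomorphism. *)
Definition hilbert_tensor n (Hi : 'I_n -> hilbert R) (H : hilbert R)
    (tau : (forall i, Hi i) -> H) :=
  [/\ forall (x : forall i, Hi i) i (a : C) (u v : Hi i),
        tau (dfwith x i (a *: u + v)) =
          a *: tau (dfwith x i u) + tau (dfwith x i v),
      forall x y : (forall i, Hi i),
        hdot (tau x) (tau y) = \prod_(i < n) hdot (x i) (y i) &
      forall (z : H) (e : R), 0 < e ->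
        exists s : seq (C * (forall i, Hi i)),
          let z' := z - \sum_(p <- s) p.1 *: tau p.2 in hdot z' z' < e%:C].

End HilbertSpaces.

Section WeilRepresentation.
Variables (R : realType) (k : naLocalFieldType).
Variables (varpi : k) (psi : k -> R[i]) (lam : int).
Variables (W : vectType k) (beta : W -> W -> k).
Local Notation C := R[i].
Local Notation half := (2%:R^-1 : k).

(* rho w t is the operator attached to the element (w, t) of H(W). *)
Definition heisenberg_rep (H : hilbert R) (rho : W -> k -> H -> H) :=
  [/\ forall w t, unitary_op (rho w t),
      forall x, rho 0 0 x = x,
      forall w t w' t' x,
        rho (w + w') (t + t' + half * beta w w') x = rho w t (rho w' t' x) &
      forall x (e : R), 0 < e ->
        \forall r \near (0 : 'rV[k]_(\dim (@fullv k W))) & t \near (0 : k),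
          let y := rho (of_coords r) t x - x in hdot y y < e%:C].

Definition irreducible_rep (H : hilbert R) (rho : W -> k -> H -> H) :=
  (exists x : H, x != 0) /\
  forall E : set H, closed_subspace E ->
    (forall w t x, E x -> E (rho w t x)) -> E = [set 0] \/ E = setT.

Definition is_rho_psi (H : hilbert R) (rho : W -> k -> H -> H) :=
  [/\ heisenberg_rep rho, irreducible_rep rho &
      forall t x, rho 0 t x = psi t *: x].

(* Mp(W), as a subgroup of pairs (g, U) *)
Definition metaplectic (H : hilbert R) (rho : W -> k -> H -> H)
    (Mp : set ('End(W) * (H -> H))) :=
  [/\ forall g U, Mp (g, U) ->
        [/\ Sp beta g, unitary_op U &
            forall w t x, U (rho w t x) = rho (g w) t (U x)],
      [/\ Mp (\1%VF, idfun),
          forall g U g' U', Mp (g, U) -> Mp (g', U') ->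
            Mp ((g \o g')%VF, U \o U') &
          forall g U, Mp (g, U) ->
            exists2 U', Mp ((g^-1)%VF, U') & U \o U' = idfun],
      forall g, Sp beta g -> exists U, Mp (g, U) &
      exists2 U0 : H -> H, U0 <> idfun &
        forall U, Mp (\1%VF, U) <-> U = idfun \/ U = U0].

(* S_{W, psi} : (g, U) |-> U *)
Definition weil (H : hilbert R) (x : 'End(W) * (H -> H)) : H -> H := x.2.

(* The integral over the discrete group W / A is a sum over the cosets. *)
Definition l2norm2 (A : set W) (f : W -> C) : \bar R :=
  \esum_(c in cosets setT A) ((complex.Re (`|f (xget 0 c)| ^+ 2))%:E).

Definition HA (A : set W) : set (W -> C) :=
  [set f | (forall a w, A a -> f (a + w) = psi (half * beta w a) * f w) /\
           (l2norm2 A f < +oo)%E].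

Definition rhoA (w : W) (t : k) (f : W -> C) : W -> C :=
  fun w' => psi (t + half * beta w' w) * f (w' + w).

(* isometric isomorphism of the model rho on H with the model H^A *)
Definition model_iso (A : set W) (H : hilbert R) (rho : W -> k -> H -> H)
    (Phi : H -> (W -> C)) :=
  [/\ forall (a : C) x y w, Phi (a *: x + y) w = a * Phi x w + Phi y w,
      range Phi = HA A,
      forall x, (complex.Re (hdot x x))%:E = l2norm2 A (Phi x) &
      forall w t x, Phi (rho w t x) = rhoA w t (Phi x)].

Section Section_sB.
Variables (B : set W) (r : reduction beta varpi lam B).
Let V := red_space r.
Variables (A : set W) (X : {vspace V}) (theta : 'End(V) -> resf k).

Definition mfactor (h : 'End(V)) : C :=
  (omega varpi psi lam (theta h))^-1 *
  omega varpi psi lam 1 ^ (1 - (jdim X h)%:Z).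

Definition SA (g : 'End(W)) (f : W -> C) : W -> C := fun w =>
  let gbar := red_end r g in
  let Q := cosets A (A `&` [set g a | a in A]) in
  mfactor gbar * sqrtq R k ^+ jdim X gbar * ((#|` fset_set Q|)%:R)^-1 *
  \sum_(c \in Q) (psi (half * beta (xget 0 c) w) *
                  f ((g^-1)%VF (xget 0 c + w))).

End Section_sB.

(* [s] is the section s_B on K_B (its values elsewhere are irrelevant): for each
   self-dual A between B and B^*, it is given by the operators S^A_psi once H is
   identified with H^A. *)
Definition is_section (B : set W) (H : hilbert R) (rho : W -> k -> H -> H)
    (Mp : set ('End(W) * (H -> H))) (s : 'End(W) -> 'End(W) * (H -> H)) :=
  (forall g, stabilizer beta B g -> Mp (s g) /\ (s g).1 = g) /\
  exists r : reduction beta varpi lam B,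
  forall A, self_dual_lattice beta lam A ->
    B `<=` A -> A `<=` dual_lattice beta lam B ->
    exists (X : {vspace red_space r}) (theta : 'End(red_space r) -> resf k)
           (Phi : H -> (W -> C)),
      [/\ forall v, v \in X <-> exists2 a, A a & red_proj r a = v,
          is_theta (@red_form _ _ _ _ _ _ r) X theta,
          model_iso A rho Phi &
          forall g, stabilizer beta B g ->
            forall x, Phi ((s g).2 x) = SA A X theta g (Phi x)].

End WeilRepresentation.

Definition sum_lattice (k : naLocalFieldType) (W : vectType k) n
    (Wi : 'I_n -> {vspace W}) (Bi : forall i, set (subvs_of (Wi i))) : set W :=
  [set w | exists2 b : (forall i, subvs_of (Wi i)),
     forall i, Bi i (b i) & w = \sum_(i < n) vsval (b i)].

(* Main.v *)
Require Import Defs.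
From HB Require Import structures.
From mathcomp Require Import all_boot all_order all_algebra all_field.
From mathcomp Require Import finmap.
From mathcomp.real_closed Require Import complex.
From mathcomp Require Import all_classical all_reals all_analysis.
From mathcomp Require Import ring lra zify.

Set Implicit Arguments.
Unset Strict Implicit.
Unset Printing Implicit Defensive.

Import Order.TTheory GRing.Theory Num.Theory.
Local Open Scope classical_set_scope.
Local Open Scope ring_scope.

(** A may be taken to be a sum because [is_section] describes s_B through every self-dual lattice
    between B and its dual. The function theta is known only through its defining clauses, none of
    which mentions orthogonal sums; this is why it has to be evaluated on an explicit decomposition
    h = tau_S p. Knowing it modulo squares suffices, since omega(c^2 a) = omega(a). The Gauss sum
    identity says that a |-> omega(a) / omega(1) is multiplicative on the non-zero residues. In m(h)
    = omega(theta(h))^-1 omega(1)^(1 - j(h)) the exponent 1 - j(h) is what absorbs the leftover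
    powers of omega(1). A model isomorphism records norms only, whence the polarization; and no
    description of the functions on W / A is needed for density, irreducibility does that work. Odd
    residue characteristic serves to make frames isotropic by halving pairings, to get omega(1) !=
    0, and to make psi(beta / 2) trivial on A x A. *)

(* Choose self-dual lattices A_i between B_i and B_i^*, let A be their sum, and
   define tau on the lattice models by (f_i)_i |-> (w |-> prod_i f_i(w_i)).  Sums
   over W / A = prod_i W_i / A_i factor, so tau multiplies squared norms, hence
   inner products by polarization; its closed span is invariant under H(W), hence
   everything by irreducibility of rho_psi.

   Both W / A and A / (A meet gA) being products, the operator S^A(g) is the
   product of the S^{A_i}(g_i) up to the constants m(g) q^{j(g)/2}, which are
   multiplicative because j is additive, theta is multiplicative modulo squares,
   and omega(a c) omega(1) = omega(a) omega(c) for the Gauss sums omega.  For theta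
   and j: two Lagrangians x and h x admit a common symplectic basis, i.e.
   h = tau_S p with p stabilizing x, so theta(h) = det(p | x) and j(h) = |S|; such
   decompositions of the components of h add up to one of h. *)

(** * Symplectic linear algebra *)

Lemma linfunE (F : fieldType) (U V : vectType F) (f : U -> V) :
  linear f -> linfun f =1 f.
Proof.
move=> lin_f v.
pose ff : {linear U -> V} := HB.pack f (GRing.isLinear.Build _ _ _ _ f lin_f).
exact: (lfunE ff).
Qed.

Lemma linear_lfun (F : fieldType) (U V : vectType F) (f : U -> V) :
  linear f -> exists g : 'Hom(U, V), g =1 f.
Proof. by move=> lin_f; exists (linfun f); apply: linfunE. Qed.

Lemma mem_span_family (F : fieldType) (V : vectType F) (I : finType)
    (e : I -> V) (v : V) :
  v \in <<[seq e i | i : I]>>%VS <-> exists c : I -> F, v = \sum_i c i *: e i.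
Proof.
split=> [|[c ->]]; last first.
  by apply: memv_suml => i _; apply/memvZ/memv_span/map_f; rewrite mem_enum.
rewrite span_def big_map big_enum /= => /memv_sumP[u u_in ->].
have {}u_in i : exists c, u i = c *: e i by apply/vlineP/u_in.
by have [c cP] := choice u_in; exists c; apply: eq_bigr => i _; apply: cP.
Qed.

(** The two matrices are conjugate by the base change [E] from [vbasis U] to [e]. Since the [e i]
    span [U], expressing [vbasis U] in them gives a left inverse of [E], so [\det E] can be
    cancelled. *)
Lemma det_mx_on (F : fieldType) (V : vectType F) (U : {vspace V}) (p : 'End(V))
    m (e : 'I_m -> V) (M : 'M[F]_m) :
  m = \dim U -> <<[seq e i | i : 'I_m]>>%VS = U ->
  (forall i, p (e i) = \sum_j M i j *: e j) -> \det (mx_on U p) = \det M.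
Proof.
move=> mE eU pe; subst m.
pose E : 'M[F]_(\dim U) := \matrix_(i, j) coord (vbasis U) j (e i).
have e_in i : e i \in U.
  by rewrite -eU; apply/memv_span/map_f; rewrite mem_enum.
have eE i : e i = \sum_j E i j *: (vbasis U)`_j.
  rewrite {1}(coord_vbasis (e_in i)).
  by apply: eq_bigr => j _; rewrite mxE.
have v_in (j : 'I_(\dim U)) : (vbasis U)`_j \in U.
  by apply/vbasis_mem/mem_nth; rewrite size_tuple.
have coord_sum (c : 'I_(\dim U) -> F) k :
    coord (vbasis U) k (\sum_j c j *: (vbasis U)`_j) = c k.
  by rewrite coord_sum_free ?(basis_free (vbasisP U)).
have GP0 (j : 'I_(\dim U)) :
    exists c : 'I_(\dim U) -> F, (vbasis U)`_j = \sum_i c i *: e i.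
  by apply/mem_span_family; rewrite eU.
have [G GP] := choice GP0.
have GE : (\matrix_(i, j) G i j) *m E = 1%:M.
  apply/matrixP => j k; rewrite !mxE.
  have := GP j; under eq_bigr => i _ do rewrite eE scaler_sumr.
  rewrite exchange_big /=.
  under eq_bigr => a _ do
    (under eq_bigr => i _ do rewrite scalerA; rewrite -scaler_suml).
  move/(congr1 (coord (vbasis U) k)); rewrite coord_sum coord_free //;
    last exact: basis_free (vbasisP U).
  by move->; apply: eq_bigr => i _; rewrite mxE.
have Eu : \det E != 0.
  apply/eqP => E0; move/(congr1 determinant): GE.
  by rewrite det_mulmx E0 mulr0 det1 => /esym/eqP; rewrite oner_eq0.
have EP : E *m mx_on U p = M *m E.
  apply/matrixP => i k; rewrite !mxE.
  transitivity (coord (vbasis U) k (p (e i))); last first.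
    rewrite pe linear_sum; apply: eq_bigr => j _.
    by rewrite linearZ /= !mxE.
  rewrite [in RHS]eE !linear_sum; apply: eq_bigr => j _.
  by rewrite !linearZ /= !mxE.
move/(congr1 determinant): EP; rewrite !det_mulmx mulrC.
exact: mulIf.
Qed.

Lemma det_mxdiag (F : comNzRingType) n (p_ : 'I_n -> nat)
    (M : forall i, 'M[F]_(p_ i)) :
  \det (\mxdiag_i M i) = \prod_i \det (M i).
Proof.
elim: n => [|n IH] in p_ M *.
  have det0 m (N : 'M[F]_m) : m = 0%N -> \det N = 1.
    by move=> m0; subst m; rewrite det_mx00.
  by rewrite det0 ?big_ord0.
have detc m m' (eq_m : m = m') (N : 'M[F]_m) :
  \det (castmx (eq_m, eq_m) N) = \det N by case: m' / eq_m; rewrite castmx_id.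
by rewrite mxdiag_recl detc det_ublock IH [RHS]big_ord_recl.
Qed.

Section SymplecticForm.
Variables (F : fieldType) (V : vectType F) (b : V -> V -> F).
Hypothesis b_sympl : symplectic_form b.

Lemma formDl u v w : b (u + v) w = b u w + b v w.
Proof. by case: b_sympl => bl _ _ _; rewrite -[u]scale1r bl mul1r scale1r. Qed.

Lemma formDr u v w : b w (u + v) = b w u + b w v.
Proof. by case: b_sympl => _ br _ _; rewrite -[u]scale1r br mul1r scale1r. Qed.

Lemma form0l w : b 0 w = 0.
Proof. by apply/(addrI (b 0 w)); rewrite -formDl !addr0. Qed.

Lemma form0r w : b w 0 = 0.
Proof. by apply/(addrI (b w 0)); rewrite -formDr !addr0. Qed.

Lemma formZl a u w : b (a *: u) w = a * b u w.
Proof. by case: b_sympl => bl _ _ _; rewrite -[a *: u]addr0 bl form0l addr0. Qed.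

Lemma formZr a u w : b w (a *: u) = a * b w u.
Proof. by case: b_sympl => _ br _ _; rewrite -[a *: u]addr0 br form0r addr0. Qed.

Lemma formNl u w : b (- u) w = - b u w.
Proof. by rewrite -scaleN1r formZl mulN1r. Qed.

Lemma formNr u w : b w (- u) = - b w u.
Proof. by rewrite -scaleN1r formZr mulN1r. Qed.

Lemma formBl u v w : b (u - v) w = b u w - b v w.
Proof. by rewrite formDl formNl. Qed.

Lemma formBr u v w : b w (u - v) = b w u - b w v.
Proof. by rewrite formDr formNr. Qed.

Lemma formvv v : b v v = 0. Proof. by case: b_sympl. Qed.

Lemma formC u v : b u v = - b v u.
Proof.
have := formvv (u + v); rewrite formDl !formDr !formvv add0r addr0 => /eqP.
by rewrite addr_eq0 => /eqP.
Qed.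

Lemma form_suml (I : Type) (r : seq I) (P : pred I) (u : I -> V) w :
  b (\sum_(i <- r | P i) u i) w = \sum_(i <- r | P i) b (u i) w.
Proof. exact: (big_morph (b ^~ w) (fun u v => formDl u v w) (form0l w)). Qed.

Lemma form_sumr (I : Type) (r : seq I) (P : pred I) (u : I -> V) w :
  b w (\sum_(i <- r | P i) u i) = \sum_(i <- r | P i) b w (u i).
Proof. exact: (big_morph (b w) (fun u v => formDr u v w) (form0r w)). Qed.

Lemma form_nondeg v : (forall w, b v w = 0) -> v = 0.
Proof. by case: b_sympl => _ _ _; apply. Qed.

(** The map sending [v] to its pairings with a basis is injective by non-degeneracy, hence onto by
    dimension. *)
Lemma riesz (phi : V -> F) :
  (forall a u v, phi (a *: u + v) = a * phi u + phi v) ->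
  exists v, forall w, b v w = phi w.
Proof.
move=> lin_phi; set e := vbasis (@fullv _ V).
have lin_b : linear (fun v => \row_(j < \dim (@fullv _ V)) b v e`_j).
  by move=> a u v; apply/rowP => j; rewrite !mxE formDl formZl.
have [L LE] := linear_lfun lin_b.
have inj_L : lker L == 0%VS.
  rewrite -subv0; apply/subvP => v; rewrite memv_ker LE memv0 => /eqP v0.
  apply/eqP/form_nondeg => w; rewrite (coord_vbasis (memvf w)) form_sumr.
  rewrite big1 // => j _; rewrite formZr.
  by move/rowP/(_ j): v0; rewrite !mxE => ->; rewrite mulr0.
have imL : limg L = fullv.
  apply/eqP; rewrite eqEdim subvf limg_dim_eq ?(eqP inj_L) ?capv0 //.
  by rewrite [X in (X <= _)%N]dimvf dim_matrix mul1r leqnn.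
have /memv_imgP[v _ vP] : \row_j phi e`_j \in limg L by rewrite imL memvf.
exists v => w; rewrite (coord_vbasis (memvf w)) form_sumr.
have phi0 : phi 0 = 0.
  have /eqP := lin_phi 1 0 0; rewrite scaler0 addr0 mul1r -subr_eq0.
  by rewrite opprD addrA subrr sub0r oppr_eq0 => /eqP.
have phi_sum : {morph phi : x y / x + y}.
  by move=> x y; rewrite -[x]scale1r lin_phi mul1r scale1r.
rewrite (big_morph phi phi_sum phi0); apply: eq_bigr => j _.
rewrite formZr -[X in phi X]addr0 lin_phi phi0 addr0; congr (_ * _).
by move/rowP/(_ j): vP; rewrite LE !mxE.
Qed.

(** For each [a], the functional pairing [w - projv U w] with [a] kills [U]. The vector representing
    it is therefore orthogonal to [U], hence to [v], so [v - projv U v] is orthogonal to every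
    [a]. *)
Lemma double_orthogonal (U : {vspace V}) v :
  (forall w, (forall u, u \in U -> b w u = 0) -> b w v = 0) -> v \in U.
Proof.
move=> vP; pose pi w := w - projv U w.
have pi_lin a u w : pi (a *: u + w) = a *: pi u + pi w.
  by rewrite /pi linearP scalerBr opprD addrACA.
suff /eqP : pi v = 0.
  by rewrite /pi subr_eq0 => /eqP ->; exact: memv_proj.
apply: form_nondeg => a.
have [|w wP] := @riesz (fun w => b (pi w) a).
  by move=> c u w; rewrite pi_lin formDl formZl.
by rewrite -wP vP // => u uU; rewrite wP /pi projv_id // subrr form0l.
Qed.

(** Being one's own orthogonal gives isotropy and maximality together, with no dimension to
    count. *)
Definition lagrangian (X : {vspace V}) :=
  forall v, v \in X <-> forall x, x \in X -> b v x = 0.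

Lemma lagrangian_isotropic X x y : lagrangian X -> x \in X -> y \in X -> b x y = 0.
Proof. by move=> lagX /lagX xP /xP. Qed.

Lemma lagrangian_max X Y : lagrangian X -> lagrangian Y -> (X <= Y)%VS -> X = Y.
Proof.
move=> lagX lagY /subvP XY; apply/eqP; rewrite eqEsubv; apply/andP; split.
  exact/subvP.
apply/subvP => y yY; apply/lagX => x /XY; exact: lagrangian_isotropic.
Qed.

Lemma Sp_inj h : Sp b h -> lker h == 0%VS.
Proof.
move=> hS; rewrite -subv0; apply/subvP => v; rewrite memv_ker memv0 => /eqP v0.
by apply/eqP/form_nondeg => w; rewrite -hS v0 form0l.
Qed.

Lemma Sp_inv h : Sp b h -> Sp b h^-1%VF.
Proof.
by move=> hS v w; rewrite -hS !lker0_lfunVK ?Sp_inj.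
Qed.

Lemma Sp_comp g h : Sp b g -> Sp b h -> Sp b (g \o h)%VF.
Proof. by move=> gS hS v w; rewrite !lfunE /= gS hS. Qed.

Lemma lagrangian_img X h : lagrangian X -> Sp b h -> lagrangian (h @: X).
Proof.
move=> lagX hS v; split=> [/memv_imgP[x xX ->] y /memv_imgP[z zX ->]|vP].
  by rewrite hS; apply: lagrangian_isotropic zX.
rewrite -[v](lker0_lfunVK (Sp_inj hS)); apply/memv_img/lagX => x xX.
by rewrite -hS lker0_lfunVK ?Sp_inj // vP // memv_img.
Qed.

(** The length [l] is free, whereas [adapted_symplectic_basis] imposes [half_dim]: a frame assembled
    from summands has a sum as its length. *)
Definition symplectic_frame l (e f : 'I_l -> V) :=
  [/\ forall i j, b (e i) (e j) = 0, forall i j, b (f i) (f j) = 0 &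
      forall i j, b (e i) (f j) = (i == j)%:R].

Lemma form_span0 (s : seq V) c w :
  (forall x, x \in s -> b x c = 0) -> w \in << s >>%VS -> b w c = 0.
Proof.
move=> s0 /(coord_span (X := in_tuple s)) ->; rewrite form_suml big1 // => i _.
by rewrite formZl s0 ?mulr0 // mem_nth.
Qed.

Lemma pairing_free (I : eqType) (g g' : I -> V) (s : seq I) :
  (forall i j, b (g i) (g' j) = (i == j)%:R) -> uniq s ->
  free [seq g i | i <- s].
Proof.
move=> gg'; elim: s => [|i s IH] /=; first by rewrite nil_free.
case/andP => i_s /IH{}IH; rewrite free_cons IH andbT; apply/negP => gi.
suff: b (g i) (g' i) = 0 by rewrite gg' eqxx => /eqP; rewrite oner_eq0.
apply: form_span0 gi => _ /mapP[j js ->]; rewrite gg'.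
by case: eqVneq => // ji; rewrite -ji js in i_s.
Qed.

Lemma frame_form l (e f : 'I_l -> V) (a c a' c' : 'I_l -> F) :
  symplectic_frame e f ->
  b (\sum_i (a i *: e i + c i *: f i)) (\sum_i (a' i *: e i + c' i *: f i)) =
    \sum_i (a i * c' i - c i * a' i).
Proof.
case=> ee ff ef; rewrite form_suml; apply: eq_bigr => i _.
rewrite form_sumr (bigD1 i) //= big1 => [|j /negPf ji].
  rewrite addr0 formDl !formDr !formZl !formZr ee ff [b (f i) _]formC ef eqxx.
  by rewrite !mulr0 add0r addr0 mulr1 mulrN1 mulrN.
rewrite formDl !formDr !formZl !formZr ee ff [b (f i) _]formC !ef ji.
by rewrite eq_sym ji oppr0 !mulr0 !addr0.
Qed.

Section Frame.
Variables (X : {vspace V}) (lagX : lagrangian X).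
Variables (l : nat) (e f : 'I_l -> V).
Hypotheses (ef_frame : symplectic_frame e f).
Hypothesis spanX : <<[seq e i | i : 'I_l]>>%VS = X.

Lemma frame_mem i : e i \in X.
Proof. by rewrite -spanX; apply/memv_span/map_f; rewrite mem_enum. Qed.

(** The difference [u] of the two sides is orthogonal to all [e j], so it lies in the Lagrangian [X]
    and is a combination of the [e j]; its coefficients are its pairings with the [f j], which
    vanish. *)
Lemma frame_expand v :
  v = \sum_i (b v (f i) *: e i + b (e i) v *: f i).
Proof.
case: (ef_frame) => ee ff ef.
set v' := \sum_i _; pose u := v - v'.
have ue j : b u (e j) = 0.
  rewrite formBl form_suml (bigD1 j) //= big1 => [|i /negPf ij].
    rewrite addr0 formDl !formZl ee [b (f j) _]formC ef eqxx mulr0 add0r mulrN1.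
    by rewrite opprK formC addNr.
  by rewrite formDl !formZl ee [b (f i) _]formC ef eq_sym ij oppr0 !mulr0 addr0.
have uf j : b u (f j) = 0.
  rewrite formBl form_suml (bigD1 j) //= big1 => [|i /negPf ij].
    by rewrite addr0 formDl !formZl ff ef eqxx mulr0 mulr1 addr0 subrr.
  by rewrite formDl !formZl ff ef ij !mulr0 addr0.
have /mem_span_family[c uE] : u \in <<[seq e i | i : 'I_l]>>%VS.
  rewrite spanX; apply/lagX => x; rewrite -spanX => /mem_span_family[c ->].
  by rewrite form_sumr big1 // => i _; rewrite formZr ue mulr0.
apply/eqP; rewrite -subr_eq0 -/u uE big1 // => j _.
suff -> : c j = 0 by rewrite scale0r.
rewrite -[RHS](uf j) uE form_suml (bigD1 j) //= big1 => [|i /negPf ij].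
  by rewrite addr0 formZl ef eqxx mulr1.
by rewrite formZl ef ij mulr0.
Qed.

Lemma frame_dim : \dim (@fullv _ V) = (l + l)%N.
Proof.
case: (ef_frame) => ee ff ef.
(* The family [e], [f] is dual to [f], [- e], hence free; the sign comes from antisymmetry. *)
pose g (s : 'I_l + 'I_l) := match s with inl i => e i | inr i => f i end.
pose g' (s : 'I_l + 'I_l) := match s with inl i => f i | inr i => - e i end.
have gg' s t : b (g s) (g' t) = (s == t)%:R.
  case: s t => [i|i] [j|j] /=; rewrite ?formNr ?ee ?ff ?oppr0 //.
  by rewrite formC opprK ef [in RHS]eq_sym.
have /eqP := pairing_free gg' (enum_uniq {: 'I_l + 'I_l}).
rewrite size_map -cardE card_sum card_ord => <-; congr (\dim _); apply/esym/eqP.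
rewrite eqEsubv subvf; apply/subvP => v _; rewrite (frame_expand v).
apply: memv_suml => i _; apply: memvD; apply/memvZ/memv_span/mapP.
  by exists (inl i) => //; rewrite mem_enum.
by exists (inr i) => //; rewrite mem_enum.
Qed.

Lemma frame_half_dim : half_dim V = l.
Proof. by rewrite /half_dim frame_dim addnn doubleK. Qed.

Lemma frame_dim_sub (s : seq 'I_l) : uniq s ->
  \dim <<[seq e i | i <- s]>> = size s.
Proof.
case: (ef_frame) => _ _ ef us; have /eqP -> := pairing_free ef us.
by rewrite size_map.
Qed.

Lemma frame_dimX : \dim X = l.
Proof.
by rewrite -spanX frame_dim_sub ?enum_uniq // -cardE card_ord.
Qed.

End Frame.

End SymplecticForm.

Lemma eq_mod_squares_refl (F : fieldType) (x : F) : eq_mod_squares x x.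
Proof. by exists 1; rewrite ?oner_eq0 // expr1n mul1r. Qed.

Lemma eq_mod_squares_trans (F : fieldType) (x y z : F) :
  eq_mod_squares x y -> eq_mod_squares y z -> eq_mod_squares x z.
Proof.
move=> [c c0 ->] [d d0 ->]; exists (c * d); first by rewrite mulf_neq0.
by rewrite exprMn mulrA.
Qed.

Lemma eq_mod_squaresM (F : fieldType) (x y z t : F) :
  eq_mod_squares x y -> eq_mod_squares z t -> eq_mod_squares (x * z) (y * t).
Proof.
move=> [c c0 ->] [d d0 ->]; exists (c * d); first by rewrite mulf_neq0.
by rewrite exprMn mulrACA.
Qed.

Lemma eq_mod_squares_sym (F : fieldType) (x y : F) :
  eq_mod_squares x y -> eq_mod_squares y x.
Proof.
move=> [c c0 ->]; exists c^-1; first by rewrite invr_neq0.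
by rewrite mulrA -exprMn mulVf // expr1n mul1r.
Qed.

Lemma eq_mod_squares_prod (F : fieldType) n (x y : 'I_n -> F) :
  (forall i, eq_mod_squares (x i) (y i)) ->
  eq_mod_squares (\prod_i x i) (\prod_i y i).
Proof.
move=> xy; apply: big_ind2 => // [|a c d g]; first exact: eq_mod_squares_refl.
exact: eq_mod_squaresM.
Qed.

(** * The function theta *)

Section Bruhat.
Variables (F : fieldType) (V : vectType F) (b : V -> V -> F).
Hypothesis b_sympl : symplectic_form b.
Hypothesis char2 : (2%:R : F) != 0.

(* In terms of the defining data of [theta], this says [h = tau_S p] where [p]
   stabilizes [X] and acts on it by the matrix [M] in the basis [e]. *)
Definition bruhat_data (X : {vspace V}) (h : 'End(V)) l (e f : 'I_l -> V)
    (S : {set 'I_l}) (M : 'M[F]_l) :=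
  [/\ symplectic_frame b e f, <<[seq e i | i : 'I_l]>>%VS = X &
      forall i, h (e i) = \sum_j M i j *: (if j \in S then f j else e j)].

(** The basis of [X] extends one of the intersection of [X] and [Y], and [S] indexes the
    complementary vectors. For [k] in [S], a dual vector kills that intersection, which is the
    orthogonal of [X + Y]; so it lies in [X + Y], and dropping its component in [X] changes no
    pairing with the [e i]. *)
Lemma bruhat_dual_basis (X Y : {vspace V}) :
  lagrangian b X -> lagrangian b Y ->
  exists l (e g : 'I_l -> V) (S : {set 'I_l}),
    [/\ <<[seq e i | i : 'I_l]>>%VS = X,
        forall i j, b (e i) (g j) = (i == j)%:R,
        forall i, i \notin S -> e i \in Y & forall i, i \in S -> g i \in Y].
Proof.
move=> lagX lagY; pose D := (X :\: Y)%VS; pose Z := (X :&: Y)%VS.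
pose s := cat_tuple (vbasis D) (vbasis Z).
have s_basis : basis_of X s.
  rewrite -[X](addv_diff_cap X Y); apply: cat_basis; try exact: vbasisP.
  apply/directv_addP/eqP; rewrite -subv0 -(capv_diff X Y) capvS //.
  exact: capvSr.
have s_free := basis_free s_basis.
pose e (i : 'I_(\dim D + \dim Z)) := s`_i.
pose S := [set i : 'I_(\dim D + \dim Z) | (i < \dim D)%N]%SET.
have eX : <<[seq e i | i : 'I_(\dim D + \dim Z)]>>%VS = X.
  rewrite -[RHS](span_basis s_basis); congr span.
  apply: (@eq_from_nth _ 0); first by rewrite size_map size_enum_ord size_tuple.
  move=> i; rewrite size_map size_enum_ord => il.
  by rewrite (nth_map (Ordinal il)) ?size_enum_ord // /e nth_enum_ord.
have eZ i : i \notin S -> e i \in Z.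
  rewrite inE -leqNgt => Di; rewrite /e nth_cat size_tuple ltnNge Di /=.
  by apply/vbasis_mem/mem_nth; rewrite size_tuple ltn_subLR.
have e_in i : e i \in X.
  by rewrite -eX; apply/memv_span/map_f; rewrite mem_enum.
have dual k : exists g, forall i, b (e i) g = (i == k)%:R.
  (* The [k]-th coordinate on [X] is extended to [V] by the projection. [riesz] puts the
     representing vector on the left, whence the sign of the witness. *)
  have [|g gP] := riesz b_sympl (phi := fun w => coord s k (projv X w)).
    by move=> a u v; rewrite !linearP.
  exists (- g) => i; rewrite (formC b_sympl) (formNl b_sympl) opprK gP.
  by rewrite projv_id // coord_free.
have dualY k : exists g, (forall i, b (e i) g = (i == k)%:R) /\
    (k \in S -> g \in Y).
  have [g gP] := dual k; have [kS|kS] := boolP (k \in S); last first.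
    by exists g; split.
  have /memv_addP[x xX [y yY gE]] : g \in (X + Y)%VS.
    apply: (double_orthogonal b_sympl) => w wP.
    have wX : w \in X.
      by apply/lagX => x xX; apply/wP/(subvP (addvSl X Y)).
    have wY : w \in Y.
      by apply/lagY => y yY; apply/wP/(subvP (addvSr X Y)).
    have wZ : w \in Z by rewrite memv_cap wX.
    rewrite (coord_vbasis wZ) (form_suml b_sympl) big1 // => i _.
    have -> : (vbasis Z)`_i = e (rshift _ i).
      by rewrite /e nth_cat size_tuple ltnNge leq_addr /= addKn.
    rewrite (formZl b_sympl) gP; case: eqP => [ik|]; last by rewrite mulr0.
    by move: kS; rewrite -ik inE /= ltnNge leq_addr.
  exists y; split=> // i.
  have -> : y = g - x by rewrite gE addrC addKr.
  by rewrite (formBr b_sympl) gP (lagrangian_isotropic lagX (e_in i) xX) subr0.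
have [g gP] := choice dualY.
exists (\dim D + \dim Z)%N, e, g, S; split=> // [i j|i iS|i iS].
- by have [-> _] := gP j.
- by have := eZ i iS; rewrite memv_cap => /andP[].
- by have [_ ->] := gP i.
Qed.

(** Apply the dual basis lemma to [X] and its image under [h]. The corrected [f i], [i] in [S], and
    the [e i], [i] outside [S], lie in this image, and isotropy kills the other coordinates of
    [h (e i)]. *)
Lemma bruhat_exists X h : lagrangian b X -> Sp b h ->
  exists l (e f : 'I_l -> V) S M, bruhat_data X h e f S M.
Proof.
move=> lagX hS; have lagY := lagrangian_img b_sympl lagX hS.
have [l [e [g [S [eX eg eY gY]]]]] := bruhat_dual_basis lagX lagY.
have e_in i : e i \in X.
  by rewrite -eX; apply/memv_span/map_f; rewrite mem_enum.
have ee i j : b (e i) (e j) = 0 by apply: (lagrangian_isotropic lagX).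
(* Subtracting from [g i], [i] outside [S], half of its pairings with the others
   makes the [f]'s isotropic without moving those in [h X]. *)
pose c i k : F := if i \in S then 0 else
  if k \in S then b (g i) (g k) else 2%:R^-1 * b (g i) (g k).
pose f i := g i - \sum_k c i k *: e k.
have ge i k : b (g i) (e k) = - (k == i)%:R.
  by rewrite (formC b_sympl) eg.
have ef i j : b (e i) (f j) = (i == j)%:R.
  rewrite (formBr b_sympl) eg (form_sumr b_sympl) big1 ?subr0 // => k _.
  by rewrite (formZr b_sympl) ee mulr0.
have ff i j : b (f i) (f j) = 0.
  rewrite [f i]/f (formBl b_sympl) (form_suml b_sympl).
  under eq_bigr => k _ do rewrite (formZl b_sympl) ef.
  rewrite (bigD1 j) //= big1 => [|k /negPf ->]; last by rewrite mulr0.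
  rewrite eqxx mulr1 addr0 (formBr b_sympl) (form_sumr b_sympl).
  under eq_bigr => k _ do rewrite (formZr b_sympl) ge.
  rewrite (bigD1 i) //= big1 => [|k /negPf ->]; last by rewrite oppr0 mulr0.
  rewrite eqxx mulrN1 addr0 opprK /c.
  (* Both indices in [S]: the vectors lie in an isotropic space. Exactly one in [S]: the other
     vector was corrected by the whole pairing. None: each was corrected by half of it. *)
  have [iS|iS] := boolP (i \in S); have [jS|jS] := boolP (j \in S).
  - by rewrite subr0 addr0 (lagrangian_isotropic lagY) ?gY.
  - by rewrite subr0 (formC b_sympl) addNr.
  - by rewrite addr0 subrr.
  rewrite [b (g j) _](formC b_sympl) mulrN -addrA -opprD -mulr2n -[_ *+ 2]mulr_natl.
  by rewrite mulrA divff // mul1r subrr.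
have fr : symplectic_frame b e f by [].
have fY i : i \in S -> f i \in (h @: X)%VS.
  move=> iS; rewrite /f big1 ?subr0 ?gY // => k _.
  by rewrite /c iS scale0r.
(* Of the two coefficients in [frame_expand], this keeps the one on [f j] for [j] in [S] and the one
   on [e j] otherwise. *)
pose M := \matrix_(i, j)
  if j \in S then b (e j) (h (e i)) else b (h (e i)) (f j).
exists l, e, f, S, M; split=> // i.
rewrite [LHS](frame_expand b_sympl lagX fr eX); apply: eq_bigr => j _.
have hY : h (e i) \in (h @: X)%VS by exact: memv_img.
rewrite mxE; have [jS|jS] := boolP (j \in S).
  by rewrite (lagrangian_isotropic lagY hY (fY _ jS)) scale0r add0r.
by rewrite (lagrangian_isotropic lagY (eY _ jS) hY) scale0r addr0.
Qed.

Lemma theta_frame (X : {vspace V}) theta l (e f : 'I_l -> V) (S : {set 'I_l})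
    (tau : 'End(V)) :
  is_theta b X theta -> half_dim V = l -> symplectic_frame b e f ->
  <<[seq e i | i : 'I_l]>>%VS = X ->
  (forall i, tau (e i) = if i \in S then f i else e i) ->
  (forall i, tau (f i) = if i \in S then - e i else f i) ->
  eq_mod_squares (theta tau) 1.
Proof.
case=> _ _ _ theta_tau lE [ee ff ef] eX tau_e tau_f; subst l.
apply: (theta_tau e f S) => [|i]; first by split.
by rewrite tau_e tau_f.
Qed.

Section BruhatTheta.
Variables (X : {vspace V}) (h : 'End(V)).
Variables (l : nat) (e f : 'I_l -> V) (S : {set 'I_l}) (M : 'M[F]_l).
Hypotheses (lagX : lagrangian b X) (hS : Sp b h).
Hypothesis hM : bruhat_data X h e f S M.

Let fr : symplectic_frame b e f. Proof. by case: hM. Qed.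
Let eX : <<[seq e i | i : 'I_l]>>%VS = X. Proof. by case: hM. Qed.

(** The swapped vectors [e'], [f'] again form a symplectic frame, so the map is an isometry. Each
    [h (e i)] is a combination of the [tau (e j)], and an inclusion of Lagrangians is an
    equality. *)
Lemma bruhat_tau : exists tau : 'End(V),
  [/\ Sp b tau, (tau @: X = h @: X)%VS,
      forall i, tau (e i) = if i \in S then f i else e i &
      forall i, tau (f i) = if i \in S then - e i else f i].
Proof.
case: (fr) => ee ff ef.
pose e' i := if i \in S then f i else e i.
pose f' i := if i \in S then - e i else f i.
have lin_tau : linear (fun v => \sum_i (b v (f i) *: e' i + b (e i) v *: f' i)).
  move=> a u v; rewrite scaler_sumr -big_split; apply: eq_bigr => i _ /=.
  rewrite (formDl b_sympl) (formDr b_sympl) (formZl b_sympl) (formZr b_sympl).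
  by rewrite !scalerDl scalerDr !scalerA addrACA.
have [tau tauE] := linear_lfun lin_tau.
have tau_e i : tau (e i) = e' i.
  rewrite tauE (bigD1 i) //= big1 => [|j /negPf ji].
    by rewrite addr0 ef ee eqxx scale1r scale0r addr0.
  by rewrite ef ee eq_sym ji !scale0r addr0.
have tau_f i : tau (f i) = f' i.
  rewrite tauE (bigD1 i) //= big1 => [|j /negPf ji].
    by rewrite addr0 ef ff eqxx scale1r scale0r add0r.
  by rewrite ef ff ji !scale0r addr0.
have fe i j : b (f i) (e j) = - (j == i)%:R by rewrite (formC b_sympl) ef.
have fr' : symplectic_frame b e' f'.
  split=> i j; rewrite /e' /f'; have [->|ij] := eqVneq i j.
  - exact: formvv.
  - case: (i \in S); case: (j \in S) => //;
    by rewrite ?ef ?fe ?(negPf ij) // eq_sym (negPf ij) oppr0.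
  - exact: formvv.
  - case: (i \in S); case: (j \in S);
    rewrite ?(formNl b_sympl) ?(formNr b_sympl) ?ee ?ff ?ef ?fe ?(negPf ij);
    by rewrite ?[j == i]eq_sym ?(negPf ij) ?oppr0.
  - by case: (j \in S); rewrite ?(formNr b_sympl) ?fe ?ef eqxx ?opprK.
  - case: (i \in S); case: (j \in S);
    rewrite ?(formNl b_sympl) ?(formNr b_sympl) ?ee ?ff ?ef ?fe ?(negPf ij);
    by rewrite ?[j == i]eq_sym ?(negPf ij) ?oppr0.
have tauS : Sp b tau.
  move=> v w; rewrite !tauE (frame_form b_sympl _ _ _ _ fr').
  rewrite [in RHS](frame_expand b_sympl lagX fr eX v).
  by rewrite [in RHS](frame_expand b_sympl lagX fr eX w) (frame_form b_sympl).
exists tau; split=> //; apply/esym; apply: (lagrangian_max (b := b)).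
- exact: lagrangian_img.
- exact: lagrangian_img.
apply/subvP => _ /memv_imgP[x xX ->].
move: xX; rewrite -{1}eX => /mem_span_family[c ->].
rewrite linear_sum; apply: memv_suml => i _; rewrite linearZ /=; apply: memvZ.
case: hM => _ _ ->; apply: memv_suml => j _; apply: memvZ.
by rewrite -[if _ then _ else _]/(e' j) -tau_e memv_img // (frame_mem eX).
Qed.

(** The map [p], the inverse of [tau] composed with [h], stabilizes [X] and has matrix [M] there,
    while [theta tau] is a square by the normalization of theta. *)
Lemma bruhat_theta theta : is_theta b X theta ->
  eq_mod_squares (theta h) (\det M).
Proof.
move=> theta_th; case: (theta_th) => _ theta_mul theta_P _.
have [tau [tauS tauX tau_e tau_f]] := bruhat_tau.
have inj_tau := Sp_inj b_sympl tauS.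
pose p := (tau^-1 \o h)%VF.
have pP : parabolic b X p.
  split; first by apply: Sp_comp => //; apply: Sp_inv.
  by rewrite limg_comp -tauX -limg_comp lker0_compVf // lim1g.
have dimX := frame_dimX b_sympl fr eX.
have theta_p : eq_mod_squares (theta p) (\det M).
  rewrite -(det_mx_on (U := X) (p := p) _ eX) //; first exact: theta_P.
  move=> i; rewrite lfunE /=; case: hM => _ _ ->.
  rewrite linear_sum; apply: eq_bigr => j _; rewrite linearZ /= -tau_e.
  by rewrite lker0_lfunK.
have idP : parabolic b X \1%VF.
  by split; [move=> v w; rewrite !lfunE | rewrite lim1g].
have theta_1 : eq_mod_squares (theta \1%VF) 1.
  rewrite -[1 in X in eq_mod_squares _ X](det1 _ l).
  rewrite -(det_mx_on (U := X) (p := \1%VF) _ eX) //; first exact: theta_P.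
  move=> i; rewrite lfunE /= (bigD1 i) //= big1 => [|j /negPf ji].
    by rewrite mxE eqxx scale1r addr0.
  by rewrite mxE eq_sym ji scale0r.
have theta_tau1 : eq_mod_squares (theta tau) 1.
  exact: (theta_frame theta_th (frame_half_dim b_sympl lagX fr eX) fr eX).
(* The equivariance clause of [is_theta] has a parabolic factor on each side; the identity fills the
   left one. *)
have -> : h = (\1 \o (tau \o p))%VF.
  by rewrite comp_lfun1l lker0_compVKf.
apply: eq_mod_squares_trans (theta_mul _ _ _ idP tauS pP) _.
rewrite -[\det M]mul1r -[1 in X in eq_mod_squares _ X]mul1r.
by do 2?[apply: eq_mod_squaresM].
Qed.

(** The [e i] with [i] outside [S] span the intersection: a vector of [X] has no [f] coordinates,
    and if it is also in [h X] its pairing with [f i], [i] in [S], vanishes because [f i] is in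
    [h X] as well. *)
Lemma bruhat_jdim : jdim X h = #|S|.
Proof.
have [tau [tauS tauX tau_e _]] := bruhat_tau.
have lagY := lagrangian_img b_sympl lagX tauS.
case: (fr) => ee ff ef.
have XY : (X :&: h @: X = <<[seq e i | i <- enum (~: S)]>>)%VS.
  rewrite -tauX; apply/vspaceP => v; apply/idP/idP; last first.
    move: v; apply/subvP/span_subvP => _ /mapP[i iS ->].
    move: iS; rewrite mem_enum inE => iS.
    rewrite memv_cap (frame_mem eX) /=.
    have -> : e i = tau (e i) by rewrite tau_e (negPf iS).
    exact/memv_img/(frame_mem eX).
  rewrite memv_cap => /andP[vX vY].
  rewrite (frame_expand b_sympl lagX fr eX v); apply: memv_suml => i _.
  rewrite [b (e i) v](lagrangian_isotropic lagX) ?(frame_mem eX) //.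
  rewrite scale0r addr0; have [iS|iS] := boolP (i \in S).
    rewrite (lagrangian_isotropic lagY) ?scale0r ?mem0v //.
    have -> : f i = tau (e i) by rewrite tau_e iS.
    exact/memv_img/(frame_mem eX).
  by apply/memvZ/memv_span/map_f; rewrite mem_enum inE.
rewrite /jdim XY (frame_half_dim b_sympl lagX fr eX).
rewrite (frame_dim_sub b_sympl fr) ?enum_uniq // -cardE.
by rewrite -[X in (X - _)%N](card_ord l) -(cardsC S) addnK.
Qed.

End BruhatTheta.
End Bruhat.

(* The summands [Vi i] are not assumed to be subspaces of [V]: this also applies
   to the reductions [Bi^* / Bi] of the summands of a lattice. *)
Definition orthogonal_sum (F : fieldType) (V : vectType F) (b : V -> V -> F)
    n (Vi : 'I_n -> vectType F) (bi : forall i, Vi i -> Vi i -> F)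
    (inj : forall i, 'Hom(Vi i, V)) (pr : forall i, 'Hom(V, Vi i)) :=
  [/\ forall v, v = \sum_i inj i (pr i v),
      forall i v, pr i (inj i v) = v,
      forall i j v, i != j -> pr j (inj i v) = 0 &
      forall v w, b v w = \sum_i bi i (pr i v) (pr i w)].

Section OrthogonalSum.
Variables (F : fieldType) (V : vectType F) (b : V -> V -> F) (n : nat).
Variables (Vi : 'I_n -> vectType F) (bi : forall i, Vi i -> Vi i -> F).
Variables (inj : forall i, 'Hom(Vi i, V)) (pr : forall i, 'Hom(V, Vi i)).
Arguments bi : clear implicits.
Hypotheses (bi_sympl : forall i, symplectic_form (bi i)).
Hypothesis V_sum : orthogonal_sum b bi inj pr.

Lemma orthogonal_sumP v w : (forall i, pr i v = pr i w) -> v = w.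
Proof.
case: V_sum => vE _ _ _ vw; rewrite (vE v) (vE w).
by apply: eq_bigr => i _; rewrite vw.
Qed.

Lemma pr_sum (u : forall i, Vi i) j : pr j (\sum_i inj i (u i)) = u j.
Proof.
case: V_sum => _ pi pij _; rewrite linear_sum (bigD1 j) //= big1 => [|i ij].
  by rewrite pi addr0.
by rewrite pij.
Qed.

Lemma form_inj i u v : b (inj i u) (inj i v) = bi i u v.
Proof.
case: V_sum => _ pi pij ->; rewrite (bigD1 i) //= big1 => [|j ji].
  by rewrite !pi addr0.
by rewrite pij 1?eq_sym // (form0l (bi_sympl j)).
Qed.

Lemma form_inj_neq i j u v : i != j -> b (inj i u) (inj j v) = 0.
Proof.
case: V_sum => _ pi pij -> ij; rewrite big1 // => m _.
have [im|im] := eqVneq i m; last by rewrite pij // (form0l (bi_sympl m)).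
by subst m; rewrite [pr i (inj j v)]pij 1?eq_sym // (form0r (bi_sympl i)).
Qed.

Lemma orthogonal_sum_symplectic : symplectic_form b.
Proof.
case: (V_sum) => vE pi pij bE; split=> [a u v w|a u v w|v|v v0].
- rewrite !bE mulr_sumr -big_split; apply: eq_bigr => i _ /=.
  by rewrite linearP (formDl (bi_sympl i)) (formZl (bi_sympl i)).
- rewrite !bE mulr_sumr -big_split; apply: eq_bigr => i _ /=.
  by rewrite linearP (formDr (bi_sympl i)) (formZr (bi_sympl i)).
- by rewrite bE big1 // => i _; rewrite formvv.
apply: orthogonal_sumP => i; rewrite linear0.
apply: (form_nondeg (bi_sympl i)) => w; rewrite -[RHS](v0 (inj i w)) bE.
rewrite (bigD1 i) //= big1 ?addr0 ?pi // => j ji.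
by rewrite [pr j (inj i w)]pij 1?eq_sym // (form0r (bi_sympl j)).
Qed.

Section Bruhat.
Variables (X : {vspace V}) (h : 'End(V)).
Variables (Xi : forall i, {vspace Vi i}) (hi : forall i, 'End(Vi i)).
Hypothesis X_sum : forall v, v \in X <-> forall i, pr i v \in Xi i.
Hypothesis h_sum : forall i v, h (inj i v) = inj i (hi i v).
Variables (l : 'I_n -> nat) (e f : forall i, 'I_(l i) -> Vi i).
Variables (S : forall i, {set 'I_(l i)}) (M : forall i, 'M[F]_(l i)).
Arguments e : clear implicits.
Arguments f : clear implicits.
Hypothesis hM : forall i, bruhat_data (bi i) (Xi i) (hi i) (e i) (f i) (S i) (M i).

Local Notation sig := (@tagnat.sig n l).
Let join (g : forall i, 'I_(l i) -> Vi i) (x : {i & 'I_(l i)}) : V :=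
  inj (tag x) (g (tag x) (tagged x)).
Let Sj := [set s | tagged (sig s) \in S (tag (sig s))]%SET.

Let reindex_sig (U : nmodType) (G : {i & 'I_(l i)} -> U) :
  \sum_s G (sig s) = \sum_i \sum_(a < l i) G (Tagged _ a).
Proof.
rewrite (reindex _ (@tagnat.rank_bij_on n l)) /=.
rewrite (eq_bigr G) => [|x _]; last by rewrite tagnat.rankK.
by rewrite sig_big_dep /=; apply: eq_bigr => -[].
Qed.

(** The frames are concatenated through the bijection [tagnat.sig] between the indices below
    [\sum_i l i] and the pairs of a summand and an index in it; [h] becomes block diagonal. *)
Lemma bruhat_sum :
  bruhat_data b X h (fun s => join e (sig s)) (fun s => join f (sig s)) Sj
    (\mxdiag_i M i).
Proof.
(* The scalar [z] treats the three conditions on a frame at once: 0 for the isotropic pairings, 1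
   for the dual one. *)
have pairing (g g' : forall i, 'I_(l i) -> Vi i) z s t :
    (forall i a c, bi i (g i a) (g' i c) = (a == c)%:R * z) ->
    b (join g (sig s)) (join g' (sig t)) = (s == t)%:R * z.
  rewrite -(inj_eq (@tagnat.sig_inj n l)) => gg'.
  case: (sig s) (sig t) => [i a] [j c]; rewrite /join /=.
  have [ij|ij] := eqVneq i j; last first.
    rewrite form_inj_neq //; case: eqP; rewrite ?mul0r // => /(congr1 tag) /= ij'.
    by rewrite ij' eqxx in ij.
  by subst j; rewrite form_inj gg' eq_Tagged.
split.
- split=> s t.
  + rewrite (pairing _ _ 0) ?mulr0 // => i a c.
    by have [[ee _ _] _ _] := hM i; rewrite ee mulr0.
  + rewrite (pairing _ _ 0) ?mulr0 // => i a c.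
    by have [[_ ff _] _ _] := hM i; rewrite ff mulr0.
  + rewrite (pairing _ _ 1) ?mulr1 // => i a c.
    by have [[_ _ ef] _ _] := hM i; rewrite ef mulr1.
- apply/vspaceP => v; apply/idP/idP.
    move: v; apply/subvP/span_subvP => _ /mapP[s _ ->].
    apply/X_sum => j; case: (sig s) => [i a]; rewrite /join /=.
    case: V_sum => _ pi pij _; have [ij|ij] := eqVneq i j.
      subst j; rewrite pi; have [_ <- _] := hM i.
      by apply/memv_span/map_f; rewrite mem_enum.
    by rewrite pij // mem0v.
  move/X_sum => vX; case: V_sum => vE _ _ _; rewrite (vE v); apply: memv_suml => i _.
  have := vX i; have [_ <- _] := hM i; move/mem_span_family => [c ->].
  rewrite linear_sum; apply: memv_suml => a _; rewrite linearZ /=.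
  apply/memvZ/memv_span/mapP.
  exists (tagnat.rank (Tagged (fun j => 'I_(l j)) (a : 'I_(l i)))).
    by rewrite mem_enum.
  by rewrite tagnat.rankK.
move=> s; pose e' i a := if a \in S i then f i a else e i a.
(* These are the entries of the block diagonal matrix as a function of pairs; [conform_mx] with
   default 0 replaces a cast along the equality of tags. *)
pose D (x y : {i & 'I_(l i)}) : F :=
  (if tag x == tag y then conform_mx 0 (M (tag x)) else 0)
    (tagged x) (tagged y).
transitivity (\sum_t D (sig s) (sig t) *: join e' (sig t)); last first.
  apply: eq_bigr => t _; rewrite mxE inE; congr (_ *: _).
  by rewrite /join /e'; case: ifP.
rewrite (reindex_sig (fun y => D (sig s) y *: join e' y)).
case: (sig s) => [i a]; rewrite /join /D /= h_sum.
have [_ _ ->] := hM i; rewrite (bigD1 i) //= [X in _ + X]big1 => [|j ji].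
  rewrite addr0 linear_sum; apply: eq_bigr => c _.
  by rewrite linearZ eqxx conform_mx_id.
by apply: big1 => c _; rewrite eq_sym (negPf ji) mxE scale0r.
Qed.

Lemma card_bruhat_sum : #|Sj| = \sum_i #|S i|.
Proof.
rewrite -sum1_card big_mkcond /=.
under eq_bigr do rewrite inE.
rewrite (reindex_sig (fun x => if tagged x \in S (tag x) then 1%N else 0%N)).
by apply: eq_bigr => i _; rewrite -sum1_card [in RHS]big_mkcond.
Qed.

End Bruhat.

Section Theta.
Hypothesis char2 : (2%:R : F) != 0.
Variables (X : {vspace V}) (h : 'End(V)) (theta : 'End(V) -> F).
Variables (Xi : forall i, {vspace Vi i}) (hi : forall i, 'End(Vi i)).
Variable thetai : forall i, 'End(Vi i) -> F.
Arguments thetai : clear implicits.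
Hypothesis X_sum : forall v, v \in X <-> forall i, pr i v \in Xi i.
Hypothesis h_sum : forall i v, h (inj i v) = inj i (hi i v).
Hypotheses (lagXi : forall i, lagrangian (bi i) (Xi i)).
Hypotheses (hiS : forall i, Sp (bi i) (hi i)).
Hypotheses (theta_th : is_theta b X theta).
Hypotheses (thetai_th : forall i, is_theta (bi i) (Xi i) (thetai i)).

Lemma lagrangian_sum : lagrangian b X.
Proof.
case: (V_sum) => _ pi pij bE v; split=> [/X_sum vX x /X_sum xX|vP].
  by rewrite bE big1 // => i _; apply: (lagrangian_isotropic (@lagXi i)) (vX i) (xX i).
apply/X_sum => i; apply/lagXi => x xX.
rewrite -[RHS](vP (inj i x)); last first.
  apply/X_sum => j; have [<-|ij] := eqVneq i j; first by rewrite pi.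
  by rewrite pij // mem0v.
rewrite bE (bigD1 i) //= big1 ?addr0 ?pi // => j ji.
by rewrite [pr j (inj i x)]pij 1?eq_sym // (form0r (bi_sympl j)).
Qed.

Lemma Sp_sum : Sp b h.
Proof.
case: (V_sum) => vE _ _ bE.
have hE v : h v = \sum_i inj i (hi i (pr i v)).
  by rewrite {1}(vE v) linear_sum; apply: eq_bigr => i _; rewrite /= h_sum.
move=> v w; rewrite bE [RHS]bE !hE; apply: eq_bigr => i _.
by rewrite !(pr_sum (fun i => hi i (pr i _))) hiS.
Qed.

Lemma theta_jdim_sum :
  eq_mod_squares (theta h) (\prod_i thetai i (hi i)) /\
  jdim X h = \sum_i jdim (Xi i) (hi i).
Proof.
have ex i := bruhat_exists (bi_sympl i) char2 (@lagXi i) (@hiS i).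
(* Five successive choices turn the existence statements into families [l], [e], [f], [S], [M]
   indexed by [i]. *)
pose c1 i := cid (ex i); pose c2 i := cid (svalP (c1 i)).
pose c3 i := cid (svalP (c2 i)); pose c4 i := cid (svalP (c3 i)).
pose c5 i := cid (svalP (c4 i)); have hM i := svalP (c5 i).
have b_sympl := orthogonal_sum_symplectic.
have hM_sum := bruhat_sum X_sum h_sum hM.
split.
  apply: eq_mod_squares_trans
    (bruhat_theta b_sympl lagrangian_sum Sp_sum hM_sum theta_th) _.
  rewrite det_mxdiag; apply: eq_mod_squares_prod => i; apply: eq_mod_squares_sym.
  exact: (bruhat_theta (bi_sympl i) (@lagXi i) (@hiS i) (hM i) (thetai_th i)).
rewrite (bruhat_jdim b_sympl lagrangian_sum Sp_sum hM_sum).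
rewrite (card_bruhat_sum (fun i => sval (c4 i))).
apply: eq_bigr => i _; apply/esym.
exact: (bruhat_jdim (bi_sympl i) (@lagXi i) (@hiS i) (hM i)).
Qed.

End Theta.
End OrthogonalSum.

(** * Gauss sums and the local field *)

Section SumOfSquares.
Variable F : finFieldType.

(** Squaring has fibres of at most two elements, and the fibre over 0 has only one, whence the
    strict inequality. *)
Lemma card_squares : (#|F| < (#|(fun x : F => x ^+ 2) @: predT|).*2)%N.
Proof.
set Sq := _ @: _.
have sq_in x : x ^+ 2 \in Sq by apply/imsetP; exists x.
rewrite -[#|F|]sum1_card (partition_big (fun x : F => x ^+ 2) (mem Sq)) //=.
have fib y : (\sum_(x : F | x ^+ 2 == y) 1 <= 2)%N.
  have [/existsP[x0 /eqP <-]|/existsPn no] := boolP [exists x : F, x ^+ 2 == y];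
    last by rewrite big1 // => x /(negP (no x)).
  rewrite sum1_card; apply: leq_trans (_ : #|[set x0; - x0]%SET| <= 2)%N.
    apply/subset_leq_card/fintype.subsetP => x /eqP xx;
    by rewrite !inE -eqf_sqr xx.
  by rewrite cards2; case: eqP.
have S0 : 0 \in Sq by rewrite -[0](expr0n F 2).
have -> : ((#|Sq|).*2 = \sum_(y in Sq) 2)%N by rewrite sum_nat_const muln2.
rewrite !(bigD1 (P := mem Sq) 0 S0) /= -addSn leq_add ?leq_sum //.
rewrite (eq_bigl (pred1 0)) ?big_pred1_eq // => x.
by rewrite sqrf_eq0.
Qed.

(** Pigeonhole: the values of [a s^2] and those of [1 - c t^2] each fill more than half of the
    field. *)
Lemma diagonal_form_represents1 (a c : F) : a != 0 -> c != 0 ->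
  exists s t, a * s ^+ 2 + c * t ^+ 2 = 1.
Proof.
move=> a0 c0; set Sq := (fun x : F => x ^+ 2) @: predT.
pose A := (fun y => a * y) @: Sq.
pose B := (fun y => 1 - c * y) @: Sq.
have cardA : #|A| = #|Sq| by apply: card_imset => x y; apply: mulfI.
have cardB : #|B| = #|Sq|.
  by apply: card_imset => x y /addrI/oppr_inj; apply: mulfI.
have /pred0Pn[z] : ~~ [disjoint A & B].
  apply/negP => /pred0P dAB; have := cardsUI A B.
  rewrite [X in (_ + X)%N](_ : _ = 0%N) ?addn0 ?cardA ?cardB ?addnn; last first.
    by apply: eq_card0 => z; have := dAB z; rewrite !inE.
  by have := max_card (mem (A :|: B)) => /[swap] ->; rewrite leqNgt card_squares.
rewrite /= => /andP[/imsetP[_ /imsetP[s _ ->] ->] /imsetP[_ /imsetP[t _ ->] zE]].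
by exists s, t; rewrite zE subrK.
Qed.

End SumOfSquares.

Section GaussSum.
Variables (C : numFieldType) (F : finFieldType) (chi : F -> C).
Hypotheses (chiD : forall x y, chi (x + y) = chi x * chi y) (chi0 : chi 0 = 1).
Hypotheses (chi_nontriv : exists x, chi x != 1) (char2 : (2%:R : F) != 0).

Definition gauss_sum a := \sum_(t : F) chi (a * t ^+ 2).

Lemma gauss_sum_square a c : c != 0 -> gauss_sum (c ^+ 2 * a) = gauss_sum a.
Proof.
move=> c0; rewrite [RHS](reindex (fun t => c * t)) /=.
  by apply: eq_bigr => t _; congr chi; ring.
by exists (fun t => c^-1 * t) => t _; rewrite ?mulVKf ?mulKf.
Qed.

(* The quadratic forms [a s^2 + c t^2] and [s^2 + a c t^2] are equivalent. *)
Lemma gauss_sumM a c : a != 0 -> c != 0 ->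
  gauss_sum a * gauss_sum c = gauss_sum 1 * gauss_sum (a * c).
Proof.
move=> a0 c0; have [s [t st1]] := diagonal_form_represents1 a0 c0.
have pairE u v : gauss_sum u * gauss_sum v =
    \sum_(p : F * F) chi (u * p.1 ^+ 2 + v * p.2 ^+ 2).
  rewrite /gauss_sum big_distrlr /= pair_bigA /=.
  by apply: eq_bigr => p _; rewrite chiD.
rewrite !pairE.
(* A change of variables of determinant [a s^2 + c t^2 = 1]; its first column is the vector on which
   the form takes the value 1, its second an orthogonal one. The inverse below is the adjugate. *)
rewrite (reindex (fun p => (p.1 * s - p.2 * c * t, p.1 * t + p.2 * a * s))) /=.
  apply: eq_bigr => -[x y] _ /=; congr chi.
  transitivity ((a * s ^+ 2 + c * t ^+ 2) * (x ^+ 2 + a * c * y ^+ 2)).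
    ring.
  by rewrite st1; ring.
exists (fun p => (a * s * p.1 + c * t * p.2, s * p.2 - t * p.1)) => -[x y] _ /=.
  by congr pair; rewrite -[RHS]mulr1 -st1; ring.
by congr pair; rewrite -[RHS]mulr1 -st1; ring.
Qed.

Lemma sum_character : \sum_t chi t = 0.
Proof.
have [x x1] := chi_nontriv.
have : chi x * (\sum_t chi t) = \sum_t chi t.
  rewrite [RHS](reindex (fun t => x + t)) /=; last first.
    by exists (fun t => - x + t) => t _; rewrite ?addKr ?addNKr.
  by rewrite mulr_sumr; apply: eq_bigr => t _; rewrite chiD.
move/eqP; rewrite -subr_eq0 -[X in _ - X]mul1r -mulrBl mulf_eq0 subr_eq0.
by rewrite (negPf x1) => /eqP.
Qed.

(** In the product with the sum at -1 the exponent is a difference of squares, that is [x y] after a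
    change of variables that divides by 2. Summing over [y] leaves only [x = 0], and the total is
    the order of the field. *)
Lemma gauss_sum1_neq0 : gauss_sum 1 != 0.
Proof.
suff : gauss_sum 1 * gauss_sum (- 1) != 0 by rewrite mulf_eq0; case/norP.
rewrite /gauss_sum big_distrlr /= pair_bigA /=.
rewrite (reindex (fun p : F * F => ((p.1 + p.2) / 2%:R, (p.1 - p.2) / 2%:R))) /=;
  last first.
  exists (fun p => (p.1 + p.2, p.1 - p.2)) => -[x y] _ /=; congr pair; by field.
under eq_bigr => p _ do
  (rewrite -chiD (_ : _ + _ = p.1 * p.2); last by field).
rewrite -(pair_bigA _ (fun x y => chi (x * y))) /= (bigD1 0) //=.
rewrite [X in _ + X]big1 => [|x x0].
  rewrite addr0 (eq_bigr (fun=> 1)) => [|y _]; last by rewrite mul0r.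
  rewrite sumr_const pnatr_eq0 -lt0n; apply/card_gt0P; by exists 0.
rewrite -[RHS]sum_character [RHS](reindex (fun t => x * t)) //=.
by exists (fun t => x^-1 * t) => t _; rewrite ?mulVKf ?mulKf.
Qed.

End GaussSum.

(** * Valuation, fractional ideals and residue map *)

Section LocalFieldTheory.
Variable k : naLocalFieldType.
Implicit Types (x y : k) (N M : int).

Lemma vval_mul x y : x != 0 -> y != 0 -> vval (x * y) = vval x + vval y.
Proof. exact: vvalM. Qed.

Lemma vval_add x y : x != 0 -> y != 0 -> x + y != 0 ->
  Num.min (vval x) (vval y) <= vval (x + y).
Proof. exact: vvalD. Qed.

Lemma residue_one : residue (1 : k) = 1.
Proof. exact: residue1. Qed.

Lemma residue_add x y : integers x -> integers y ->
  residue (x + y) = residue x + residue y.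
Proof. exact: residueD. Qed.

Lemma residue_mul x y : integers x -> integers y ->
  residue (x * y) = residue x * residue y.
Proof. exact: residueM. Qed.

Lemma residue_lift (a : resf k) : exists2 x, integers x & residue x = a.
Proof. exact: residue_surj. Qed.

Lemma residue_kernel x : integers x -> residue x = 0 <-> (x == 0) || (0 < vval x).
Proof. exact: residue_ker. Qed.

Lemma vval1 : vval (1 : k) = 0.
Proof.
have := vval_mul (oner_neq0 k) (oner_neq0 k); rewrite mulr1 => /eqP.
by rewrite -subr_eq0 opprD addrA subrr sub0r oppr_eq0 => /eqP.
Qed.

Lemma vvalV x : x != 0 -> vval x^-1 = - vval x.
Proof.
move=> x0; have xV : x^-1 != 0 by rewrite invr_eq0.
by apply/eqP; rewrite -subr_eq0 opprK -vval_mul // mulVf // vval1.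
Qed.

Lemma vvalN1 : vval (- 1 : k) = 0.
Proof.
have n1 : (- 1 : k) != 0 by rewrite oppr_eq0 oner_eq0.
by have := vval_mul n1 n1; rewrite mulrNN mulr1 vval1; lia.
Qed.

Lemma pideal0 N : pideal N (0 : k).
Proof. by rewrite /pideal /= eqxx. Qed.

Lemma pidealM N M x y : pideal N x -> pideal M y -> pideal (N + M) (x * y).
Proof.
rewrite /pideal /=; have [->|x0] := eqVneq x 0; first by rewrite mul0r eqxx.
have [->|y0] := eqVneq y 0; first by rewrite mulr0 eqxx.
by rewrite /= vval_mul // => xN yM; rewrite lerD ?orbT.
Qed.

Lemma pidealN N x : pideal N x -> pideal N (- x).
Proof.
move=> xN; rewrite -mulN1r -[N]add0r; apply: pidealM => //.
by rewrite /pideal /= vvalN1 lexx orbT.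
Qed.

Lemma pidealD N x y : pideal N x -> pideal N y -> pideal N (x + y).
Proof.
rewrite /pideal /=; have [->|x0] := eqVneq x 0; first by rewrite add0r.
have [->|y0] := eqVneq y 0; first by rewrite addr0 (negPf x0).
have [//|xy0] := eqVneq (x + y) 0; rewrite /= => xN yN.
by apply: le_trans (vval_add x0 y0 xy0); rewrite le_min xN.
Qed.

Lemma pideal_sum N (I : Type) (r : seq I) (P : pred I) (f : I -> k) :
  (forall i, P i -> pideal N (f i)) -> pideal N (\sum_(i <- r | P i) f i).
Proof. by move=> fN; apply: big_ind => //; [exact: pideal0 | exact: pidealD]. Qed.

Lemma pideal_le N M x : M <= N -> pideal N x -> pideal M x.
Proof.
rewrite /pideal /= => MN /orP[->//|xN]; by rewrite (le_trans MN xN) orbT.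
Qed.

Lemma integers1 : integers (1 : k).
Proof. by rewrite /integers /pideal /= vval1 lexx orbT. Qed.

Lemma integersZ N x y : integers x -> pideal N y -> pideal N (x * y).
Proof. by move=> x0 yN; rewrite -[N]add0r; apply: pidealM. Qed.

Lemma vval_exprz x N : x != 0 -> vval (x ^ N) = vval x * N.
Proof.
move=> x0; have nat_case (m : nat) : vval (x ^+ m) = vval x * m%:Z.
  elim: m => [|m IH]; first by rewrite expr0 vval1 mulr0.
  rewrite exprS vval_mul ?expf_neq0 // IH; lia.
case: N => m; first exact: nat_case.
by rewrite NegzE -exprnN vvalV ?expf_neq0 // nat_case; lia.
Qed.

Section Uniformizer.
Variables (varpi : k) (varpi_unif : uniformizer varpi).

Lemma uniformizer_neq0 : varpi != 0. Proof. by case: varpi_unif. Qed.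

Lemma pideal_uniformizer N : pideal N (varpi ^ N).
Proof.
case: varpi_unif => v0 v1.
by rewrite /pideal /= vval_exprz // v1 mul1r lexx orbT.
Qed.

Lemma pideal_exprz N M x : pideal N x <-> pideal (M + N) (varpi ^ M * x).
Proof.
split=> [|xN]; first exact/pidealM/pideal_uniformizer.
have -> : x = varpi ^ (- M) * (varpi ^ M * x).
  by rewrite mulrA -expfzDr ?uniformizer_neq0 // addNr mul1r.
by rewrite -[N](addKr M); apply: pidealM xN; apply: pideal_uniformizer.
Qed.

End Uniformizer.

Lemma residue0 : residue (0 : k) = 0.
Proof. by apply/(residue_kernel (pideal0 0)); rewrite eqxx. Qed.

Lemma residue_eq0 x : integers x -> residue x = 0 <-> pideal 1 x.
Proof. by move=> x0; split=> [/(residue_kernel x0)|/(residue_kernel x0)]. Qed.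

Lemma residueN x : integers x -> residue (- x) = - residue x.
Proof.
move=> x0; have xN := pidealN x0.
apply/eqP; rewrite -subr_eq0 opprK -residue_add //.
by rewrite addNr residue0.
Qed.

Lemma residue_eq x y : integers x -> integers y ->
  residue x = residue y <-> pideal 1 (x - y).
Proof.
move=> x0 y0; have yN := pidealN y0.
rewrite -residue_eq0; last exact: pidealD.
rewrite residue_add // residueN //; split=> [->|/eqP]; first exact: subrr.
by rewrite subr_eq0 => /eqP.
Qed.

Section OddResidue.
Hypothesis odd_residue : 2%N \notin [pchar resf k].

Lemma two_resf_neq0 : (2%:R : resf k) != 0.
Proof. by move: odd_residue; apply: contra => two0; apply/andP; split. Qed.

Lemma residue2 : residue (2%:R : k) = 2%:R.
Proof.
by rewrite mulr2n residue_add ?residue_one ?integers1 //; exact: integers1.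
Qed.

(** The residue of 2 is non-zero, so 2 is a unit. *)
Lemma integers_half : integers (2%:R^-1 : k).
Proof.
have i2 : integers (2%:R : k) by rewrite mulr2n; apply: pidealD; exact: integers1.
have two0 : (2%:R : k) != 0.
  by apply/eqP => two0; have := two_resf_neq0; rewrite -residue2 two0 residue0 eqxx.
have v2 : vval (2%:R : k) = 0.
  have := residue_eq0 i2; rewrite residue2 /pideal /= (negPf two0) /= => r2.
  have : ~~ (1 <= vval (2%:R : k)).
    by apply/negP => /r2 /eqP; rewrite (negPf two_resf_neq0).
  by move: i2; rewrite /integers /pideal /= (negPf two0) /=; lia.
by rewrite /integers /pideal /= vvalV // v2 oppr0 lexx orbT.
Qed.

End OddResidue.
End LocalFieldTheory.

(** * The normalized Gauss sums omega *)

Section Omega.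
Variables (R : realType) (k : naLocalFieldType).
Hypothesis odd_residue : 2%N \notin [pchar resf k].
Variables (varpi : k) (varpi_unif : uniformizer varpi).
Variables (psi : k -> R[i]) (lam : int).
Hypotheses (psi_char : unitary_character psi) (psi_cond : has_conductor psi lam).

Lemma psiD x y : psi (x + y) = psi x * psi y. Proof. by case: psi_char. Qed.

Lemma psi0 : psi 0 = 1.
Proof. by case: psi_cond => psi1 _; apply/psi1/pideal0. Qed.

Lemma psi_sum (I : Type) (r : seq I) (P : pred I) (f : I -> k) :
  psi (\sum_(i <- r | P i) f i) = \prod_(i <- r | P i) psi (f i).
Proof. exact: (big_morph psi psiD psi0). Qed.

(** Two lifts of a residue differ by an element of [pideal 1]; multiplied by [varpi ^ (lam - 1)] it
    falls into the ideal on which [psi] is trivial. *)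
Lemma psibar_residue x : integers x ->
  psibar varpi psi lam (residue x) = psi (varpi ^ (lam - 1) * x).
Proof.
move=> x0; rewrite /psibar.
have [y0 yx] : [set y : k | integers y /\ residue y = residue x]
    (xget 0 [set y : k | integers y /\ residue y = residue x]).
  by apply: xgetPex; exists x.
move: (xget _ _) y0 yx => y y0 /(residue_eq y0 x0) yx.
rewrite -[y](subrK x) mulrDr psiD; case: psi_cond => -> //; rewrite ?mul1r //.
by have /(pideal_exprz varpi_unif _ (lam - 1)) := yx; rewrite subrK.
Qed.

Lemma psibarD a b : psibar varpi psi lam (a + b) =
  psibar varpi psi lam a * psibar varpi psi lam b.
Proof.
have [x x0 <-] := residue_lift a; have [y y0 <-] := residue_lift b.
rewrite -residue_add // !psibar_residue // ?mulrDr ?psiD //.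
exact: pidealD.
Qed.

Lemma psibar0 : psibar varpi psi lam 0 = 1.
Proof.
by rewrite -(residue0 k) psibar_residue ?mulr0 ?psi0 //; apply: pideal0.
Qed.

Lemma psibar_nontrivial : exists a, psibar varpi psi lam a != 1.
Proof.
case: psi_cond => _ [x xP x1].
pose y := varpi ^ (1 - lam) * x.
have yI : integers y.
  have /(pideal_exprz varpi_unif _ (1 - lam)) := xP.
  by rewrite /integers (_ : _ + _ = 0) //; lia.
exists (residue y); rewrite psibar_residue // /y mulrA -expfzDr.
  by rewrite (_ : _ + _ = 0) ?expr0z ?mul1r //; lia.
exact: uniformizer_neq0 varpi_unif.
Qed.

Local Notation om := (omega varpi psi lam).
Local Notation chi := (fun x => psibar varpi psi lam (2%:R^-1 * x)).

(** The factor one half is absorbed into the character [chi], so that the Gauss sum lemmas apply as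
    they stand. *)
Lemma omegaE a : om a = (sqrtq R k)^-1 * gauss_sum chi a.
Proof.
by rewrite /omega /gauss_sum; under [in RHS]eq_bigr do rewrite mulrA.
Qed.

Let chiD x y : chi (x + y) = chi x * chi y.
Proof. by rewrite /= mulrDr psibarD. Qed.

Let chi0 : chi 0 = 1. Proof. by rewrite /= mulr0 psibar0. Qed.

Let chi_nontriv : exists x, chi x != 1.
Proof.
have [a a1] := psibar_nontrivial; exists (2%:R * a).
by rewrite /= mulKf // two_resf_neq0.
Qed.

Lemma omega_eq_mod_squares a b : eq_mod_squares a b -> om a = om b.
Proof. by move=> [c c0 ->]; rewrite !omegaE gauss_sum_square. Qed.

Lemma sqrtq_neq0 : sqrtq R k != 0.
Proof.
rewrite /sqrtq; apply/eqP => /(congr1 (@complex.Re R)) /= /eqP.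
rewrite sqrtr_eq0 leNgt ltr0n; apply/negP/negPn/card_gt0P; by exists 0.
Qed.

Lemma omega1_neq0 : om 1 != 0.
Proof.
rewrite omegaE mulf_neq0 ?invr_neq0 ?sqrtq_neq0 //.
exact: gauss_sum1_neq0 chiD chi0 chi_nontriv (two_resf_neq0 odd_residue).
Qed.

Lemma omegaM a b : a != 0 -> b != 0 -> om (a * b) = om a * om b / om 1.
Proof.
move=> a0 b0; apply/(mulIf omega1_neq0); rewrite divfK ?omega1_neq0 //.
rewrite !omegaE mulrACA [RHS]mulrACA (gauss_sumM chiD a0 b0).
by congr (_ * _); exact: mulrC.
Qed.

(** [omegaM] makes [om a / om 1] multiplicative in [a]; the leading [om 1] undoes the normalization
    on the left. *)
Lemma omega_prod n (a : 'I_n -> resf k) : (forall i, a i != 0) ->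
  om (\prod_i a i) = om 1 * \prod_i (om (a i) / om 1).
Proof.
move=> a0; elim: n a a0 => [|n IH] a a0; first by rewrite !big_ord0 mulr1.
rewrite !big_ord_recr /= omegaM //; last by apply/prodf_neq0 => i _.
by rewrite IH // -!mulrA.
Qed.

End Omega.

(** * Lattices and their duals *)

Section Topology.
Variable k : naLocalFieldType.

Lemma nbhs_pideal (x : k) (U : set k) :
  nbhs x U <-> exists N : int, forall y, pideal N (y - x) -> U y.
Proof. exact: nbhs_vvalE. Qed.

Lemma near_pideal (x : k) N : \forall y \near x, pideal N (y - x).
Proof. by apply/nbhs_pideal; exists N. Qed.

Section Functions.
Variable T : topologicalType.
Implicit Types f g : T -> k.

Lemma continuous_addk f g : continuous f -> continuous g ->
  continuous (fun x => f x + g x).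
Proof.
move=> cf cg x U /nbhs_pideal[N NU].
have fN : \forall y \near x, pideal N (f y - f x).
  exact: (cf x _ (near_pideal (f x) N)).
have gN : \forall y \near x, pideal N (g y - g x).
  exact: (cg x _ (near_pideal (g x) N)).
suff : \forall y \near x, U (f y + g y) by [].
apply: filterS2 fN gN => y fy gy; apply: NU.
by rewrite opprD addrACA; apply: pidealD.
Qed.

Lemma continuous_mulkl (c : k) f : continuous f -> continuous (fun x => c * f x).
Proof.
move=> cf x U /nbhs_pideal[N NU]; suff : \forall y \near x, U (c * f y) by [].
have [c0|c0] := eqVneq c 0.
  by apply: filterE => y; apply: NU; rewrite /= c0 !mul0r subrr; apply: pideal0.
have fN : \forall y \near x, pideal (N - vval c) (f y - f x).
  exact: (cf x _ (near_pideal (f x) (N - vval c))).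
apply: filterS fN => y fy; apply: NU.
rewrite -mulrBr -[N](subrKC (vval c)); apply: pidealM => //.
by rewrite /pideal /= lexx orbT.
Qed.

Lemma continuous_sumk (I : Type) (r : seq I) (f : I -> T -> k) :
  (forall i, continuous (f i)) -> continuous (fun x => \sum_(i <- r) f i x).
Proof.
move=> cf; elim: r => [|i r IH].
  by under eq_fun do rewrite big_nil; move=> x; apply: cvg_cst.
by under eq_fun do rewrite big_cons; apply: continuous_addk.
Qed.

Lemma continuous_rV d (f : T -> 'rV[k]_d) :
  (forall j, continuous (fun x => f x 0 j)) -> continuous f.
Proof.
move=> cf x U [P PM PU].
suff : \forall y \near x, forall j, P 0 j (f y 0 j).
  by apply: filterS => y yP; apply: PU => i j; rewrite ord1.
by apply: filter_forall => j; apply: cf; apply: PM.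
Qed.

End Functions.

Lemma continuous_entry d (j : 'I_d) : continuous (fun r : 'rV[k]_d => r 0 j).
Proof.
move=> r U rU; exists (fun _ j' => if j' == j then U else setT).
  by move=> i j'; rewrite ord1; case: eqP => [->//|_]; apply: filterT.
by move=> s sP; have := sP 0 j; rewrite eqxx.
Qed.

End Topology.

Section Coordinates.
Variables (k : naLocalFieldType) (W : vectType k).
Local Notation e := (vbasis (@fullv k W)).

Lemma vcoordsK : cancel (@vcoords k W) (@of_coords k W).
Proof.
move=> w; rewrite [RHS](coord_vbasis (memvf w)).
by apply: eq_bigr => i _; rewrite mxE.
Qed.

Lemma of_coordsK : cancel (@of_coords k W) (@vcoords k W).
Proof.
move=> r; apply/rowP => j; rewrite mxE coord_sum_free //.
exact: basis_free (vbasisP _).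
Qed.

Lemma vcoords_image (L : set W) : @vcoords k W @` L = @of_coords k W @^-1` L.
Proof.
apply/seteqP; split=> [_ [w Lw <-]|r Lr] /=; first by rewrite vcoordsK.
by exists (of_coords r) => //; rewrite of_coordsK.
Qed.

Lemma of_coordsD r s : @of_coords k W (r + s) = of_coords r + of_coords s.
Proof.
by rewrite -big_split; apply: eq_bigr => i _; rewrite mxE scalerDl.
Qed.

Lemma of_coordsN r : @of_coords k W (- r) = - of_coords r.
Proof.
by rewrite -sumrN; apply: eq_bigr => i _; rewrite mxE scaleNr.
Qed.

End Coordinates.

Lemma continuous_lfun_coords (k : naLocalFieldType) (U W : vectType k)
    (f : 'Hom(U, W)) : continuous (fun r => vcoords (f (of_coords r))).
Proof.
apply: continuous_rV => j.
have -> : (fun r => vcoords (f (of_coords r)) 0 j) = fun r =>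
    \sum_(i < \dim (@fullv _ U))
      coord (vbasis fullv) j (f (vbasis (@fullv _ U))`_i) * r 0 i.
  apply/funext => r; rewrite mxE !linear_sum; apply: eq_bigr => i _.
  by rewrite !linearZ /= mulrC.
by apply: continuous_sumk => i; apply/continuous_mulkl/continuous_entry.
Qed.

Section Lattices.
Variables (k : naLocalFieldType) (W : vectType k).
Local Notation e := (vbasis (@fullv k W)).
Implicit Types (L B : set W).

Definition integer_submodule L :=
  [/\ L 0, forall u v, L u -> L v -> L (u + v) &
      forall a u, integers a -> L u -> L (a *: u)].

Lemma lattice_submodule L : lattice L -> integer_submodule L.
Proof. by case. Qed.

Lemma submoduleN L u : integer_submodule L -> L u -> L (- u).
Proof.
by case=> _ _ Lz Lu; rewrite -scaleN1r; apply: Lz => //; apply/pidealN/integers1.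
Qed.

Lemma submoduleB L u v : integer_submodule L -> L u -> L v -> L (u - v).
Proof.
by move=> sL Lu Lv; case: (sL) => _ Ld _; apply: Ld => //; apply: submoduleN.
Qed.

Lemma lattice_open L : lattice L ->
  exists N, forall w, (forall i, pideal N (coord e i w)) -> L w.
Proof.
case=> L0 _ _ oL _; move: oL; rewrite vcoords_image openE => /(_ 0) /=.
have <- : vcoords 0 = 0 :> 'rV[k]_(\dim (@fullv k W)).
  by apply/rowP => i; rewrite !mxE linear0.
rewrite vcoordsK => /(_ L0) [P PM PL].
have PM' j : exists N, forall y, pideal N y -> P 0 j y.
  have /nbhs_pideal[N NP] := PM 0 j; exists N => y yN; apply: NP.
  by rewrite mxE linear0 subr0.
have [N NP] := choice PM'.
(* A sum of absolute values is an exponent at least as large as each [N j]. *)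
exists (\sum_j `|N j|%N%:Z) => w wN; rewrite -[w]vcoordsK.
apply: PL => i j; rewrite ord1 mxE; apply: NP.
apply: pideal_le (wN j); rewrite (bigD1 j) //=.
apply: (@le_trans _ _ `|N j|%N%:Z); first by lia.
by rewrite lerDl sumr_ge0.
Qed.

(** Near each point the bound [- n] holds for all large [n]; compactness, in its near-covering form,
    gives one [n] for the whole lattice. *)
Lemma lattice_bounded L : lattice L ->
  exists N, forall w, L w -> forall i, pideal N (coord e i w).
Proof.
case=> _ _ _ _ cptL.
pose P (n : nat) (r : 'rV[k]_(\dim (@fullv k W))) :=
  forall j, pideal (- n%:Z) (r 0 j).
have /compact_near_coveringP/(_ nat \oo P _) := cptL.
case=> [r _|n _ LP].
  pose n0 := (\sum_j `|vval (r 0%R j)|)%N.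
  have near_j j : \forall s \near r, pideal (- n0%:Z) ((s : 'rV[k]_ _) 0 j - r 0 j).
    exact: (continuous_entry (near_pideal (r 0 j) (- n0%:Z))).
  exists ([set s | forall j, pideal (- n0%:Z) ((s : 'rV[k]_ _) 0 j - r 0 j)],
          [set n | (n0 <= n)%N]).
    by split; [exact: (filter_forall _ near_j) | exists n0].
  move=> [s n] [/= sP n0n] j; apply: (@pideal_le _ (- n0%:Z)); first by lia.
  rewrite -[s 0 j](subrK (r 0 j)); apply: pidealD => //.
  rewrite /pideal /= /n0 (bigD1 j) //=; apply/orP; right.
  by rewrite PoszD opprD; lia.
exists (- n%:Z) => w Lw i; have := LP n (leqnn n) (vcoords w).
by move=> /(_ (ex_intro2 _ _ w Lw erefl)) /(_ i); rewrite mxE.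
Qed.

Definition functional (f : W -> k) :=
  forall a u v, f (a *: u + v) = a * f u + f v.

(* Descending along the coordinate flag splits off one integral generator of [L]
   at a time; the generator [b] has a last coordinate of minimal valuation. *)
Lemma lattice_functional L : lattice L -> forall u,
  (forall f, functional f -> (forall w, L w -> integers (f w)) -> integers (f u)) ->
  L u.
Proof.
move=> latL; have sL := lattice_submodule latL.
have [N1 openL] := lattice_open latL; have [N2 boundL] := lattice_bounded latL.
case: (sL) => L0 Ld Lz.
pose flag m (w : W) := forall i : 'I_(\dim (@fullv k W)),
  (m <= i)%N -> coord e i w = 0.
(* At level [m] the test functionals need only be integral on the part of [L] lying in the flag. For
   [m] the full dimension this is the statement to prove. *)
suff claim m u : flag m u -> (forall f, functional f ->
    (forall w, L w -> flag m w -> integers (f w)) -> integers (f u)) -> L u.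
  move=> u uP; apply: (claim (\dim (@fullv k W))) => [i|f fl fL].
    by rewrite leqNgt ltn_ord.
  by apply: uP => // w Lw; apply: fL => // i; rewrite leqNgt ltn_ord.
elim: m u => [|m IH] u uf uP.
  rewrite (coord_vbasis (memvf u)) big1 // => i _.
  by rewrite uf // scale0r.
have [dm|md] := leqP (\dim (@fullv k W)) m.
  have flS w : flag m w <-> flag m.+1 w.
    by split=> wf i mi; apply: wf; have := ltn_ord i; lia.
  by apply: IH; [apply/flS | move=> f fl fL; apply: uP => // w Lw /flS; apply: fL].
pose i0 := Ordinal md; pose c (w : W) : k := coord e i0 w.
have cE a v w : c (a *: v + w) = a * c v + c w by rewrite /c linearP.
(* [N2] bounds these valuations from below, so the shift by [N2] lets the minimum be taken over
   natural numbers. Openness of [L] supplies a candidate, a multiple of the basis vector. *)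
pose P n := `[< exists b, [/\ L b, flag m.+1 b, c b != 0 & vval (c b) = N2 + n%:Z] >].
have exP : exists n, P n.
  have [pi [pi0 pi1]] : exists pi : k, uniformizer pi.
    have [x x0 x1] := @vval_normalized k; by exists x.
  pose b := pi ^ N1 *: e`_i0.
  have cb i : coord e i b = pi ^ N1 * (i0 == i)%:R.
    rewrite -(coord_free i0 i (basis_free (vbasisP (@fullv k W)))).
    by rewrite /b linearZ.
  have Lb : L b.
    apply: openL => i; rewrite cb; case: eqP => _; rewrite ?mulr1 ?mulr0.
      exact: pideal_uniformizer.
    exact: pideal0.
  have cb0 : c b != 0.
    by rewrite /c cb eqxx mulr1 expfz_neq0.
  have vb : N2 <= vval (c b).
    by have := boundL _ Lb i0; rewrite /pideal /= -/(c b) (negPf cb0).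
  exists `|vval (c b) - N2|%N; apply/asboolP; exists b; split=> //.
    move=> i mi; rewrite cb; case: eqP => [i0i|_]; last by rewrite mulr0.
    by move: mi; rewrite -i0i /= ltnn.
  by rewrite gez0_abs ?subr_ge0 // subrKC.
case: (ex_minnP exP) => n /asboolP[b [Lb bf cb0 vb]] n_min.
(* Minimality of the valuation makes [g] integral on [L] at this level, so [g] is itself a test
   functional and [g u] is integral. *)
pose g w := c w / c b.
have gE a v w : g (a *: v + w) = a * g v + g w by rewrite /g cE mulrDl mulrA.
have gL w : L w -> flag m.+1 w -> integers (g w).
  move=> Lw wf; rewrite /integers /pideal /= /g.
  have [->|cw0] := eqVneq (c w) 0; first by rewrite mul0r eqxx.
  have cbV : (c b)^-1 != 0 by rewrite invr_eq0.
  rewrite vval_mul // vvalV // subr_ge0 vb; apply/orP; right.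
  have vw : N2 <= vval (c w).
    by have := boundL _ Lw i0; rewrite /pideal /= -/(c w) (negPf cw0).
  have : P `|vval (c w) - N2|%N.
    by apply/asboolP; exists w; split=> //; rewrite gez0_abs ?subr_ge0 // subrKC.
  by move/n_min; lia.
have gu : integers (g u) by apply: uP.
have flB w : flag m.+1 w -> flag m (w - g w *: b).
  move=> wf i mi; rewrite linearB linearZ /=.
  have [mi'|] := ltnP m i; first by rewrite wf // bf // mulr0 subr0.
  move=> im; have -> : i = i0 by apply/val_inj/eqP; rewrite /= eqn_leq im.
  by rewrite -/(c w) -/(c b) divfK // subrr.
have -> : u = (u - g u *: b) + g u *: b by rewrite subrK.
apply: Ld; last exact: Lz.
apply: IH => [|f fl fL]; first exact: flB.
(* A test functional of level [m] becomes one of level [m.+1] when composed with the projection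
   along [b]. *)
apply: (uP (fun w => f (w - g w *: b))) => [a v w|w Lw wf].
  rewrite -fl; congr f; rewrite gE scalerDl scalerBr scalerA opprD.
  by rewrite addrACA.
apply: fL; last exact: flB.
by apply: submoduleB => //; apply: Lz => //; apply: gL.
Qed.

(** [L] and its complement are both unions of cosets of the open subgroup [B]. *)
Lemma submodule_open_closed L B : integer_submodule L -> lattice B -> B `<=` L ->
  open (@vcoords k W @` L) /\ closed (@vcoords k W @` L).
Proof.
move=> sL latB BL; rewrite vcoords_image.
have oB (r : 'rV[k]_(\dim (@fullv k W))) :
    \forall s \near r, B (of_coords ((s : 'rV[k]_ _) - r)).
  have [N NB] := lattice_open latB.
  have near_j j : \forall s \near r, pideal N ((s : 'rV[k]_ _) 0 j - r 0 j).
    exact: (continuous_entry (near_pideal (r 0 j) N)).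
  apply: filterS (filter_forall _ near_j) => s sP; apply: NB => i.
  have /rowP/(_ i) := of_coordsK (s - r); rewrite mxE => ->.
  by rewrite !mxE.
split.
  rewrite openE => r /= Lr; apply: filterS (oB r) => s /BL.
  rewrite of_coordsD of_coordsN /= => Ls.
  rewrite -[of_coords s](subrK (of_coords r)).
  by case: sL => _ Ld _; apply: Ld.
rewrite -openC openE => r /= Lr; apply: filterS (oB r) => s /BL Ls /= Ls'.
apply: Lr; move: Ls; rewrite of_coordsD of_coordsN => Ls.
rewrite -[of_coords r](subKr (of_coords s)).
by apply: submoduleB.
Qed.

(** Compactness holds because [L] is closed in the compact set [c^-1 B], the image of [B] under a
    continuous map. *)
Lemma lattice_between L B (c : k) : c != 0 -> integer_submodule L -> lattice B ->
  B `<=` L -> (forall u, L u -> B (c *: u)) -> lattice L.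
Proof.
move=> c0 sL latB BL cLB; have [oL cL] := submodule_open_closed sL latB BL.
case: (sL) => L0 Ld Lz; split=> //.
have [f fE] : exists f : 'End(W), f =1 (fun v => c^-1 *: v).
  apply: linear_lfun => a u v; rewrite scalerDr !scalerA.
  by rewrite [c^-1 * a]mulrC.
have cpt : compact ((fun r => vcoords (f (of_coords r))) @` (@vcoords k W @` B)).
  apply: continuous_compact; last by case: latB.
  exact/continuous_subspaceT/continuous_lfun_coords.
apply: (subclosed_compact cL cpt) => _ [w Lw <-].
exists (vcoords (c *: w)); first by exists (c *: w) => //; apply: cLB.
by rewrite vcoordsK fE scalerA mulVf // scale1r.
Qed.

End Lattices.

(** An isotropic subspace of maximal dimension works: a vector orthogonal to it can be adjoined
    without losing isotropy, hence already belongs to it. *)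
Lemma lagrangian_exists (F : fieldType) (V : vectType F) (b : V -> V -> F) :
  symplectic_form b -> exists X, lagrangian b X.
Proof.
move=> b_sympl; pose isotropic (X : {vspace V}) := forall x y,
  x \in X -> y \in X -> b x y = 0.
pose P n := `[< exists X : {vspace V}, isotropic X /\ \dim X = n >].
have exP : exists n, P n.
  exists 0%N; apply/asboolP; exists 0%VS; rewrite dimv0; split=> // x y.
  by rewrite memv0 => /eqP -> _; apply: form0l.
have leP n : P n -> (n <= \dim (@fullv _ V))%N.
  by move=> /asboolP[X [_ <-]]; apply/dimvS/subvf.
case: (ex_maxnP exP leP) => n /asboolP[X [isoX dimX]] maxX.
exists X => v; split=> [vX x|vP]; first exact: isoX.
have : P (\dim (X + <[v]>)).
  apply/asboolP; exists (X + <[v]>)%VS; split=> // x y.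
  case/memv_addP=> x1 x1X [_ /vlineP[a ->] ->].
  case/memv_addP=> y1 y1X [_ /vlineP[c ->] ->].
  rewrite (formDl b_sympl) !(formDr b_sympl) !(formZl b_sympl) !(formZr b_sympl).
  rewrite (isoX _ _ x1X y1X) (vP _ y1X) (formvv b_sympl) (formC b_sympl x1) vP //.
  by rewrite oppr0 !mulr0 !addr0.
move/maxX; rewrite -dimX => dimXv.
have /eqP -> : X == (X + <[v]>)%VS by rewrite eqEdim addvSl.
by apply/(subvP (addvSr _ _))/memv_line.
Qed.

(** * Duality of lattices and the symplectic space of a good lattice *)

Section DualLattice.
Variables (k : naLocalFieldType) (W : vectType k) (beta : W -> W -> k).
Variables (varpi : k) (lam : int).
Hypotheses (varpi_unif : uniformizer varpi) (beta_sympl : symplectic_form beta).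
Implicit Types (A B L : set W).
Local Notation dual := (dual_lattice beta lam).

Lemma dual_submodule L : integer_submodule (dual L).
Proof.
split=> [x _|u v uL vL x Lx|a u aI uL x Lx].
- by rewrite (form0l beta_sympl); apply: pideal0.
- by rewrite (formDl beta_sympl); apply: pidealD; [apply: uL | apply: vL].
by rewrite (formZl beta_sympl); apply: integersZ => //; apply: uL.
Qed.

Lemma dualS L A : L `<=` A -> dual A `<=` dual L.
Proof. by move=> LA v vA x /LA; apply: vA. Qed.

(** If [f] is integral on [L], the vector representing [varpi ^ lam * f] lies in the dual, so [f] is
    integral at every point of the double dual; [lattice_functional] concludes. *)
Lemma double_dual L : lattice L -> dual (dual L) `<=` L.
Proof.
move=> latL u uLL; apply: (lattice_functional latL) => f fl fL.
have [|v vP] := riesz beta_sympl (phi := fun w => varpi ^ lam * f w).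
  by move=> a x y; rewrite fl mulrDr mulrCA.
have vL : dual L v.
  move=> w Lw; rewrite vP -[lam in pideal lam]addr0.
  exact: (pideal_exprz varpi_unif 0 lam (f w)).1 (fL _ Lw).
have := uLL v vL; rewrite (formC beta_sympl) vP => /pidealN; rewrite opprK.
by rewrite -[lam in pideal lam]addr0 => /(pideal_exprz varpi_unif 0 lam).
Qed.

Lemma stabilizer_dual B g u : stabilizer beta B g -> dual B u -> dual B (g u).
Proof.
by move=> [gS gB] uB x; rewrite -gB => -[y By <-]; rewrite gS; apply: uB.
Qed.

Section Reduction.
Variables (B : set W) (r : reduction beta varpi lam B).
Hypothesis B_good : good_lattice beta varpi lam B.
Local Notation proj := (red_proj r).
Local Notation form := (@red_form _ _ _ _ _ _ r).

(** As [varpi *: v] lies in [B], the product [varpi * beta u v] is in [pideal lam]. *)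
Lemma dual_form_integers u v :
  dual B u -> dual B v -> integers (varpi ^ (1 - lam) * beta u v).
Proof.
case: B_good => _ dB _ uB vB.
have /uB : B (varpi *: v) by apply: dB; exists v.
rewrite (formZr beta_sympl) -[varpi in pideal _ (varpi * _)]expr1z => uv.
have : pideal (1 + (lam - 1)) (varpi ^ 1 * beta u v) by rewrite subrKC.
move/(pideal_exprz varpi_unif (lam - 1) 1 _).2.
move/(pideal_exprz varpi_unif (lam - 1) (1 - lam) _).1.
by rewrite /integers (_ : _ + _ = 0) //; lia.
Qed.

Lemma red_proj0 : proj 0 = 0.
Proof.
have [d0 _ _] := dual_submodule B; apply/red_proj_ker => //.
by case: B_good => /lattice_submodule[].
Qed.

Lemma red_projN u : dual B u -> proj (- u) = - proj u.
Proof.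
move=> uB; have uN := submoduleN (dual_submodule B) uB.
by apply/eqP; rewrite -addr_eq0 -red_projD // addNr red_proj0.
Qed.

Lemma red_projB u v : dual B u -> dual B v -> proj (u - v) = proj u - proj v.
Proof.
move=> uB vB; rewrite red_projD ?red_projN //.
exact: submoduleN (dual_submodule B) vB.
Qed.

Lemma red_proj_eq u v : dual B u -> dual B v -> proj u = proj v <-> B (u - v).
Proof.
move=> uB vB; have uv := submoduleB (dual_submodule B) uB vB.
rewrite -(red_proj_ker r uv) red_projB //.
by split=> [->|/eqP]; rewrite ?subrr // subr_eq0 => /eqP.
Qed.

(** Bilinearity is checked on lifts. Non-degeneracy is the double dual property: a class orthogonal
    to everything comes from an element of the dual of the dual of [B]. *)
Lemma red_form_symplectic : symplectic_form form.
Proof.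
have [d0 dD dZ] := dual_submodule B.
have lift (x : red_space r) := red_proj_surj x; have int := dual_form_integers.
split=> [a x y z|a x y z|x|x xP].
- have [u uB <-] := lift x; have [v vB <-] := lift y; have [w wB <-] := lift z.
  have [c c0 <-] := residue_lift a.
  have cu := dZ _ _ c0 uB; rewrite -red_projZ // -red_projD // !red_formE //;
    last exact: dD.
  rewrite (formDl beta_sympl) (formZl beta_sympl) mulrDr mulrCA.
  have iu := int _ _ uB wB; have iv := int _ _ vB wB.
  have ic : integers (c * (varpi ^ (1 - lam) * _)) := integersZ c0 iu.
  by rewrite (residue_add ic iv) (residue_mul c0 iu).
- have [u uB <-] := lift x; have [v vB <-] := lift y; have [w wB <-] := lift z.
  have [c c0 <-] := residue_lift a.
  have cu := dZ _ _ c0 uB; rewrite -red_projZ // -red_projD // !red_formE //;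
    last exact: dD.
  rewrite (formDr beta_sympl) (formZr beta_sympl) mulrDr mulrCA.
  have iu := int _ _ wB uB; have iv := int _ _ wB vB.
  have ic : integers (c * (varpi ^ (1 - lam) * _)) := integersZ c0 iu.
  by rewrite (residue_add ic iv) (residue_mul c0 iu).
- have [u uB <-] := lift x.
  by rewrite red_formE // (formvv beta_sympl) mulr0 residue0.
have [u uB ux] := lift x; rewrite -ux; apply/red_proj_ker => //.
have [latB _ _] := B_good; apply: (double_dual latB) => v vB.
have := xP (proj v); rewrite -ux red_formE // => /(residue_eq0 (int _ _ uB vB)).
rewrite -[X in pideal X (varpi ^ _ * _)](subrK lam).
exact: (pideal_exprz varpi_unif lam (1 - lam) _).2.
Qed.

Lemma red_end_Sp g : stabilizer beta B g -> Sp form (red_end r g).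
Proof.
move=> gB x y; have [u uB <-] := red_proj_surj x.
have [v vB <-] := red_proj_surj y; rewrite !red_endE //.
rewrite !red_formE //; try exact: stabilizer_dual.
by case: gB => ->.
Qed.

Lemma dual_mem_residue u v : dual B u -> dual B v ->
  form (proj u) (proj v) = 0 <-> pideal lam (beta u v).
Proof.
move=> uB vB; rewrite red_formE // residue_eq0; last exact: dual_form_integers.
rewrite -[X in pideal X (varpi ^ _ * _)](subrK lam).
exact: iff_sym (pideal_exprz varpi_unif lam (1 - lam) _).
Qed.

Lemma red_lagrangian A (X : {vspace red_space r}) :
  self_dual_lattice beta lam A -> A `<=` dual B ->
  (forall v, v \in X <-> exists2 a, A a & proj a = v) -> lagrangian form X.
Proof.
move=> [_ AA] AB XA x; split=> [/XA[a Aa <-] y /XA[c Ac <-]|xP].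
  apply/dual_mem_residue; try exact: AB.
  by move: Aa; rewrite {1}AA; apply.
have [u uB ux] := red_proj_surj x; apply/XA; exists u => //.
rewrite AA => a Aa; apply/dual_mem_residue; [exact: uB | exact: AB|].
by rewrite ux xP //; apply/XA; exists a.
Qed.

(** The inverse image of a Lagrangian of the reduction: self-duality of the lattice translates into
    the Lagrangian being its own orthogonal. *)
Lemma self_dual_exists :
  exists A, [/\ self_dual_lattice beta lam A, B `<=` A & A `<=` dual B].
Proof.
have [X lagX] := lagrangian_exists red_form_symplectic.
have [latB dB BB] := B_good; have [d0 dD dZ] := dual_submodule B.
pose A : set W := [set u | dual B u /\ proj u \in X].
have BA : B `<=` A.
  move=> u Bu; have uB := BB _ Bu; split=> //.
  by have /(red_proj_ker r uB) -> := Bu; apply: mem0v.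
have sA : integer_submodule A.
  split=> [|u v [uB uX] [vB vX]|a u aI [uB uX]].
  - by split; rewrite ?red_proj0 ?mem0v.
  - by split; [exact: dD | rewrite red_projD ?memvD].
  by split; [exact: dZ | rewrite red_projZ ?memvZ].
exists A; split=> //; last by move=> u [].
split.
  apply: lattice_between (uniformizer_neq0 varpi_unif) sA latB BA _ => u [uB _].
  by apply: dB; exists u.
apply/seteqP; split=> [u [uB uX] v [vB vX]|u uA].
  by apply/dual_mem_residue => //; apply: lagrangian_isotropic uX vX.
have uB : dual B u by apply: dualS uA.
split=> //; apply/lagX => x xX; have [v vB vx] := red_proj_surj x.
by rewrite -vx; apply/dual_mem_residue => //; apply: uA; split; rewrite ?vx.
Qed.

End Reduction.
End DualLattice.

Lemma finite_vspace (F : finFieldType) (V : vectType F) : finite_set [set: V].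
Proof.
pose f (r : 'rV[F]_(\dim (@fullv _ V))) := \sum_i r 0 i *: (vbasis fullv)`_i : V.
have -> : [set: V] = f @` [set: 'rV[F]_(\dim (@fullv _ V))].
  apply/seteqP; split=> // v _; exists (\row_i coord (vbasis fullv) i v) => //.
  rewrite [RHS](coord_vbasis (memvf v)).
  by apply: eq_bigr => i _; rewrite mxE.
exact/finite_image/finite_finset.
Qed.

(** * Sums over cosets *)

Section TupleSums.
Variable T : choiceType.

Definition tuples_in n (S : 'I_n -> set T) : set (n.-tuple T) :=
  [set t | forall i, S i (tnth t i)].

Lemma tuples_in0 (S : 'I_0 -> set T) : tuples_in S = [set [tuple]].
Proof.
by apply/seteqP; split=> [t _|t _] /=; [rewrite tuple0 | case].
Qed.

Lemma tuples_in_cons n (S : 'I_n.+1 -> set T) :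
  set_bij (S ord0 `*` tuples_in (fun i => S (lift ord0 i))) (tuples_in S)
    (fun p => cons_tuple p.1 p.2).
Proof.
split=> [[x t] [/= Sx St] i|[x t] [y u] _ _ /= xu|].
- by have [j ->|->] := unliftP ord0 i; rewrite ?tnthS ?tnth0.
- have [xy tu] : x = y /\ tval t = tval u by case: (congr1 val xu).
  by rewrite xy (val_inj tu).
case/tupleP=> x t St; exists (x, t) => //; split=> [|i] /=.
  by have := St ord0; rewrite tnth0.
by have := St (lift ord0 i); rewrite tnthS.
Qed.

Lemma prod_tuple_cons (C : comNzRingType) n (a : 'I_n.+1 -> T -> C) x
    (t : n.-tuple T) :
  \prod_i a i (tnth (cons_tuple x t) i) =
  a ord0 x * \prod_i a (lift ord0 i) (tnth t i).
Proof.
rewrite big_ord_recl tnth0; congr (_ * _).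
by apply: eq_bigr => i _; rewrite tnthS.
Qed.

Lemma finite_tuples_in n (S : 'I_n -> set T) :
  (forall i, finite_set (S i)) -> finite_set (tuples_in S).
Proof.
elim: n S => [|n IH] S finS; first by rewrite tuples_in0.
have [_ _ surj] := tuples_in_cons S; apply: sub_finite_set surj _.
by apply/finite_image/finite_setX => //; apply: IH.
Qed.

Lemma prod_fsum (C : fieldType) n (S : 'I_n -> set T) (a : 'I_n -> T -> C) :
  (forall i, finite_set (S i)) ->
  \sum_(t \in tuples_in S) \prod_i a i (tnth t i) =
  \prod_i \sum_(x \in S i) a i x.
Proof.
elim: n S a => [|n IH] S a finS.
  by rewrite tuples_in0 fsbig_set1 !big_ord0.
rewrite (reindex_fsbig _ _ _ _ (tuples_in_cons S)) big_ord_recl -IH //.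
rewrite mulr_fsuml; under [RHS]eq_fsbigr do rewrite mulr_fsumr.
rewrite pair_fsbig //; last exact: finite_tuples_in.
by apply: eq_fsbigr => p _; rewrite prod_tuple_cons.
Qed.

Lemma ge0_esumZl (R : realType) (I : choiceType) (S : set I) (r : R)
    (a : I -> \bar R) : 0 <= r -> (forall i, 0 <= a i)%E ->
  (\esum_(i in S) (r%:E * a i) = r%:E * \esum_(i in S) a i)%E.
Proof.
move=> r0 a0; rewrite /esum -ereal_supZl //; last first.
  by apply/set0P; exists (\sum_(x \in set0) a x)%E, set0 => //; exact: fsets_set0.
congr ereal_sup; rewrite image_comp; apply: eq_imagel => X _ /=.
by rewrite ge0_mule_fsumr.
Qed.

(** Tonelli, one factor at a time; as the values [s i] are real, the partial products are real
    constants that leave the extended sums. *)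
Lemma prod_esum (R : realType) n (S : 'I_n -> set T) (a : 'I_n -> T -> R)
    (s : 'I_n -> R) : (forall i x, 0 <= a i x) ->
  (forall i, \esum_(x in S i) (a i x)%:E = (s i)%:E) ->
  \esum_(t in tuples_in S) (\prod_i a i (tnth t i))%:E = (\prod_i s i)%:E.
Proof.
elim: n S a s => [|n IH] S a s a0 aS.
  by rewrite tuples_in0 esum_set1 !big_ord0 ?lee01.
have p0 (t : n.-tuple T) : 0 <= \prod_(i < n) a (lift ord0 i) (tnth t i).
  by apply: prodr_ge0.
rewrite (reindex_esum _ _ _ _ (tuples_in_cons S)).
have IH' := IH (fun i => S (lift ord0 i)) (fun i => a (lift ord0 i))
  (fun i => s (lift ord0 i)) (fun i => a0 _) (fun i => aS _).
transitivity (\esum_(x in S ord0) \esum_(t in tuples_in (fun i => S (lift ord0 i)))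
    (a ord0 x * \prod_i a (lift ord0 i) (tnth t i))%:E).
  rewrite esum_esum => [|x t _ _]; last by rewrite lee_fin mulr_ge0.
  rewrite (_ : S ord0 `*`` _ = S ord0 `*` tuples_in (fun i => S (lift ord0 i))) //.
  by apply: eq_esum => p _; rewrite prod_tuple_cons.
transitivity (\esum_(x in S ord0) ((\prod_i s (lift ord0 i))%:E * (a ord0 x)%:E)%E).
  apply: eq_esum => x _; under eq_esum do rewrite EFinM.
  by rewrite ge0_esumZl // IH' muleC.
have s0 : 0 <= \prod_(i < n) s (lift ord0 i).
  apply: prodr_ge0 => i _; rewrite -lee_fin -aS.
  by apply: esum_ge0 => x _; rewrite lee_fin.
rewrite ge0_esumZl //; last by move=> x; rewrite lee_fin.
by rewrite aS -EFinM big_ord_recl mulrC.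
Qed.

End TupleSums.

Section Cosets.
Variables (K : naLocalFieldType) (W : vectType K).
Implicit Types (M L c : set W).

Definition subgroup L := L 0 /\ forall u v, L u -> L v -> L (u - v).

Lemma subgroupN L u : subgroup L -> L u -> L (- u).
Proof. by case=> L0 LB Lu; rewrite -sub0r; apply: LB. Qed.

Lemma subgroupD L u v : subgroup L -> L u -> L v -> L (u + v).
Proof.
by move=> sL Lu Lv; rewrite -[v]opprK; case: (sL) => _; apply=> //; apply: subgroupN.
Qed.

Local Notation coset L x := [set x + y | y in L].

Lemma coset_eq L x x' : subgroup L -> L (x - x') -> coset L x = coset L x'.
Proof.
move=> sL xx'; apply/seteqP; split=> _ [y Ly <-].
  exists (x - x' + y); first exact: subgroupD.
  by rewrite addrA subrKC.
exists (y - (x - x')); first by case: sL => _; apply.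
by rewrite opprB addrC -addrA subrK addrC.
Qed.

Lemma coset_xget L x : subgroup L -> L (xget 0 (coset L x) - x).
Proof.
move=> [L0 _]; have [y Ly <-] : coset L x (xget 0 (coset L x)).
  by apply: xgetPex; exists x, 0; rewrite ?addr0.
by rewrite addrC addKr.
Qed.

Lemma coset_repr L c M : subgroup L -> cosets M L c -> c = coset L (xget 0 c).
Proof.
move=> sL [x _ <-]; apply/esym/coset_eq => //; exact: coset_xget.
Qed.

End Cosets.

Section CosetSums.
Variables (k : naLocalFieldType) (W : vectType k) (beta : W -> W -> k) (n : nat).
Variables (U : 'I_n -> vectType k) (bi : forall i, U i -> U i -> k).
Variables (inj : forall i, 'Hom(U i, W)) (pr : forall i, 'Hom(W, U i)).
Hypothesis W_sum : orthogonal_sum beta bi inj pr.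
Variables (M D : set W) (Mi Di : forall i, set (U i)).
Arguments Mi : clear implicits.
Arguments Di : clear implicits.
Hypothesis M_sum : forall w, M w <-> forall i, Mi i (pr i w).
Hypothesis D_sum : forall w, D w <-> forall i, Di i (pr i w).
Hypothesis Di_subgroup : forall i, subgroup (Di i).
Hypothesis MiD : forall i u d, Mi i u -> Di i d -> Mi i (u + d).

Let D_subgroup : subgroup D.
Proof.
split; first by apply/D_sum => i; rewrite linear0; case: (Di_subgroup i).
move=> u v /D_sum uD /D_sum vD; apply/D_sum => i; rewrite linearB.
by case: (Di_subgroup i) => _; apply.
Qed.

Let inj_pr i u : pr i (inj i u) = u. Proof. by case: W_sum. Qed.

Let coset i (u : U i) := [set u + y | y in Di i].

(** The representatives are moved into [W] because the spaces [U i] are different types, while a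
    tuple needs all its entries in one. *)
Definition coset_reps i : set W :=
  [set inj i (xget 0 c) | c in cosets (Mi i) (Di i)].

Lemma coset_reps_bij i :
  set_bij (cosets (Mi i) (Di i)) (coset_reps i) (fun c => inj i (xget 0 c)).
Proof.
apply: inj_bij => c c' /set_mem cD /set_mem c'D /(congr1 (pr i)).
rewrite !inj_pr => cc'.
rewrite (coset_repr (Di_subgroup i) cD) (coset_repr (Di_subgroup i) c'D).
by rewrite cc'.
Qed.

Lemma coset_reps_mem i w : coset_reps i w ->
  [/\ w = inj i (pr i w), Mi i (pr i w) & pr i w = xget 0 (coset (pr i w))].
Proof.
move=> [c cD <-]; rewrite !inj_pr; split=> //.
  case: cD => u uM <-; rewrite -[xget _ _](subrKC u); apply: MiD => //.
  exact: coset_xget.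
by rewrite /coset -(coset_repr (Di_subgroup i) cD).
Qed.

Lemma pr_coset_reps (t : n.-tuple W) i : tuples_in coset_reps t ->
  pr i (\sum_j tnth t j) = pr i (tnth t i).
Proof.
move=> tR; transitivity (pr i (\sum_j inj j (pr j (tnth t j)))).
  by congr (pr i _); apply: eq_bigr => j _; have [] := coset_reps_mem (tR j).
by rewrite (pr_sum W_sum (fun j => pr j (tnth t j))).
Qed.

(** This is the identification of [M / D] with the product of the quotients. For injectivity, each
    entry is determined by its coset, being the chosen representative of it. *)
Lemma tuples_cosets_bij :
  set_bij (tuples_in coset_reps) (cosets M D)
    (fun t => [set \sum_i tnth t i + y | y in D]).
Proof.
split=> [t tR|t t' /set_mem tR /set_mem t'R tt'|c [x xM <-]].
- exists (\sum_i tnth t i) => //; apply/M_sum => i; rewrite pr_coset_reps //.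
  by have [] := coset_reps_mem (tR i).
- have tD : D (\sum_i tnth t i - \sum_i tnth t' i).
    have : [set \sum_i tnth t' i + y | y in D] (\sum_i tnth t i).
      by rewrite -tt'; exists 0; rewrite ?addr0 //; case: D_subgroup.
    by case=> y yD <-; rewrite addrC addKr.
  apply: eq_from_tnth => i.
  have [wE _ tE] := coset_reps_mem (tR i); have [w'E _ t'E] := coset_reps_mem (t'R i).
  rewrite wE w'E tE t'E; congr (inj i (xget 0 _)); apply: coset_eq => //.
  by have /D_sum/(_ i) := tD; rewrite linearB /= !pr_coset_reps.
pose t := [tuple inj i (xget 0 (coset (pr i x))) | i < n].
have tR : tuples_in coset_reps t.
  move=> i; rewrite tnth_mktuple; exists (coset (pr i x)) => //.
  by exists (pr i x) => //; move/M_sum: xM.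
exists t => //; apply: coset_eq => //; apply/D_sum => i.
by rewrite linearB /= pr_coset_reps // tnth_mktuple inj_pr; apply: coset_xget.
Qed.

(** The representative chosen for a coset of [D] need not be the sum of those chosen in the
    summands; the discrepancy lies in the [Di i], and functions invariant under these do not see
    it. *)
Lemma pr_xget_coset t i : tuples_in coset_reps t ->
  exists2 d, Di i d &
    pr i (xget 0 [set \sum_j tnth t j + y | y in D]) = pr i (tnth t i) + d.
Proof.
move=> tR; have /D_sum/(_ i) := coset_xget (\sum_j tnth t j) D_subgroup.
rewrite linearB /= pr_coset_reps // => dD; eexists; first exact: dD.
by rewrite subrKC.
Qed.

Section Sums.
Variables (T : Type) (g : forall i, U i -> T).
Arguments g : clear implicits.
Hypothesis g_inv : forall i u d, Mi i u -> Di i d -> g i (u + d) = g i u.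

Lemma coset_invariant t i : tuples_in coset_reps t ->
  g i (pr i (xget 0 [set \sum_j tnth t j + y | y in D])) = g i (pr i (tnth t i)).
Proof.
move=> tR; have [d dD ->] := pr_xget_coset i tR; apply: g_inv => //.
by have [] := coset_reps_mem (tR i).
Qed.

End Sums.

Lemma coset_fsum (C : fieldType) (g : forall i, U i -> C) :
  (forall i, finite_set (cosets (Mi i) (Di i))) ->
  (forall i u d, Mi i u -> Di i d -> g i (u + d) = g i u) ->
  \sum_(c \in cosets M D) \prod_i g i (pr i (xget 0 c)) =
  \prod_i \sum_(c \in cosets (Mi i) (Di i)) g i (xget 0 c).
Proof.
move=> finD g_inv; rewrite (reindex_fsbig _ _ _ _ tuples_cosets_bij).
transitivity (\sum_(t \in tuples_in coset_reps) \prod_i g i (pr i (tnth t i))).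
  apply: eq_fsbigr => t /set_mem tR.
  by apply: eq_bigr => i _; rewrite (coset_invariant g_inv).
rewrite (prod_fsum (fun i w => g i (pr i w))) => [|i]; last exact: finite_image.
apply: eq_bigr => i _; rewrite (reindex_fsbig _ _ _ _ (coset_reps_bij i)).
by apply: eq_fsbigr => c _; rewrite inj_pr.
Qed.

Lemma coset_esum (R : realType) (g : forall i, U i -> R) (s : 'I_n -> R) :
  (forall i u, 0 <= g i u) ->
  (forall i u d, Mi i u -> Di i d -> g i (u + d) = g i u) ->
  (forall i, \esum_(c in cosets (Mi i) (Di i)) (g i (xget 0 c))%:E = (s i)%:E) ->
  \esum_(c in cosets M D) (\prod_i g i (pr i (xget 0 c)))%:E = (\prod_i s i)%:E.
Proof.
move=> g0 g_inv gs; rewrite (reindex_esum _ _ _ _ tuples_cosets_bij).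
rewrite -(prod_esum (S := coset_reps) (a := fun i w => g i (pr i w)) (s := s)) //.
  apply: eq_esum => t tR; congr (_%:E).
  by apply: eq_bigr => i _; rewrite (coset_invariant g_inv).
move=> i; rewrite (reindex_esum _ _ _ _ (coset_reps_bij i)) -gs.
by apply: eq_esum => c _; rewrite inj_pr.
Qed.

End CosetSums.

(** * Hilbert tensor products *)

Section HilbertTheory.
Variables (R : realType) (H : hilbert R).
Implicit Types (x y z : H) (a : R[i]).

Lemma hdotDl x y z : hdot (x + y) z = hdot x z + hdot y z.
Proof. by rewrite -[x]scale1r hdot_linear mul1r scale1r. Qed.

Lemma hdot0l z : hdot 0 z = 0.
Proof. by apply: (addrI (hdot 0 z)); rewrite -hdotDl !addr0. Qed.

Lemma hdotZl a x z : hdot (a *: x) z = a * hdot x z.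
Proof. by rewrite -[a *: x]addr0 hdot_linear hdot0l addr0. Qed.

Lemma hdotDr x y z : hdot z (x + y) = hdot z x + hdot z y.
Proof. by rewrite hdot_conj hdotDl rmorphD /= -!hdot_conj. Qed.

Lemma hdotZr a x z : hdot z (a *: x) = conjc a * hdot z x.
Proof. by rewrite hdot_conj hdotZl rmorphM /= -hdot_conj. Qed.

Definition norm2 x : R := complex.Re (hdot x x).

Lemma norm2E x : hdot x x = (norm2 x)%:C%C.
Proof.
rewrite /norm2; have := hdot_ge0 x; rewrite lecE => /andP[+ _].
by case: (hdot x x) => u v /= /eqP ->.
Qed.

Lemma norm2_lt x (e : R) : (hdot x x < e%:C%C) = (norm2 x < e).
Proof. by rewrite norm2E ltcR. Qed.

Lemma norm2_ge0 x : 0 <= norm2 x.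
Proof. by have := hdot_ge0 x; rewrite norm2E lecR. Qed.

Lemma norm2_eq0 x : norm2 x = 0 -> x = 0.
Proof. by move=> x0; apply: hdot_eq0; rewrite norm2E x0. Qed.

Lemma norm2Z a x : norm2 (a *: x) = complex.Re (`|a| ^+ 2) * norm2 x.
Proof.
rewrite /norm2 hdotZl hdotZr mulrA norm2E; case: a => u v.
by rewrite normc_def -rmorphXn /= sqr_sqrtr ?addr_ge0 ?sqr_ge0 //=; ring.
Qed.

(** The parallelogram law with one term dropped, a triangle inequality without square roots. *)
Lemma norm2D_le x y : norm2 (x + y) <= 2%:R * norm2 x + 2%:R * norm2 y.
Proof.
have := norm2_ge0 (x - y).
rewrite /norm2 -scaleN1r !(hdotDl, hdotDr, hdotZl, hdotZr) rmorphN1 /= !mulN1r.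
move: (hdot x x) (hdot x y) (hdot y x) (hdot y y) => [a1 a2] [b1 b2] [c1 c2] [d1 d2].
by rewrite /=; lra.
Qed.

Lemma unitary_norm2 (U : H -> H) x : unitary_op U -> norm2 (U x) = norm2 x.
Proof. by case=> _ Uh _; rewrite /norm2 Uh. Qed.

End HilbertTheory.

(** Expanding at [a *: x + y] gives one relation between [P x y] and [P y x] for each [a]; those for
    1 and for i force both to vanish. *)
Lemma sesquilinear_polarization (R : realType) (H : lmodType R[i])
    (P : H -> H -> R[i]) :
  (forall a x y z, P (a *: x + y) z = a * P x z + P y z) ->
  (forall a x y z, P z (a *: x + y) = conjc a * P z x + P z y) ->
  (forall x, P x x = 0) -> forall x y, P x y = 0.
Proof.
move=> Pl Pr Pxx x y.
have anti a : a * P x y + conjc a * P y x = 0.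
  by have := Pxx (a *: x + y); rewrite Pl !Pr !Pxx mulr0 add0r addr0.
have := anti 1; have := anti 'i%C; move: (P x y) (P y x) => [u v] [u' v'] /=.
move=> /eqP; rewrite eq_complex /= => /andP[/eqP h1 /eqP h2].
move=> /eqP; rewrite eq_complex /= => /andP[/eqP h3 /eqP h4].
by apply/eqP; rewrite eq_complex /=; apply/andP; split; apply/eqP; lra.
Qed.

Section Tensor.
Variables (R : realType) (n : nat) (Hi : 'I_n -> hilbert R) (H : hilbert R).
Variable tau : (forall i, Hi i) -> H.
Hypothesis tau_linear : forall (x : forall i, Hi i) i (a : R[i]) (u v : Hi i),
  tau (dfwith x i (a *: u + v)) = a *: tau (dfwith x i u) + tau (dfwith x i v).
Hypothesis tau_norm : forall x, hdot (tau x) (tau x) = \prod_i hdot (x i) (x i).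

(* Polarization in one tensor factor after the other. *)
Lemma tensor_hdot x y : hdot (tau x) (tau y) = \prod_i hdot (x i) (y i).
Proof.
(* [x] and [y] may differ only at indices below [m]; at [m = 0] they coincide and [tau_norm]
   applies. *)
suff claim m : forall x y, (forall i : 'I_n, (m <= i)%N -> x i = y i) ->
    hdot (tau x) (tau y) = \prod_i hdot (x i) (y i).
  by apply: (claim n) => i; rewrite leqNgt ltn_ord.
elim: m => [|m IH] {}x {}y xy.
  have -> : y = x by apply: functional_extensionality_dep => i; rewrite xy.
  exact: tau_norm.
have [nm|mn] := leqP n m.
  by apply: IH => i mi; have := ltn_ord i; lia.
pose i0 := Ordinal mn.
have dfK (z : forall i, Hi i) : dfwith z i0 (z i0) = z.
  apply: functional_extensionality_dep => j; have [<-|ij] := eqVneq i0 j.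
    by rewrite dfwithin.
  by rewrite dfwithout.
pose c := \prod_(i < n | i != i0) hdot (x i) (y i).
have prodE u v : \prod_i hdot (dfwith x i0 u i) (dfwith y i0 v i) = hdot u v * c.
  rewrite (bigD1 i0) //= !dfwithin; congr (_ * _).
  by apply: eq_bigr => i ii0; rewrite !dfwithout // eq_sym.
(* [P] is the defect as a sesquilinear form in the slot [i0]. On its diagonal the two tensors agree
   in that slot, so the induction hypothesis applies. *)
pose P u v := hdot (tau (dfwith x i0 u)) (tau (dfwith y i0 v)) - hdot u v * c.
suff P0 : P (x i0) (y i0) = 0.
  by move/eqP: P0; rewrite /P subr_eq0 -prodE !dfK => /eqP.
apply: sesquilinear_polarization => [a u v w|a u v w|u].
- by rewrite /P tau_linear !(hdotDl, hdotZl); ring.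
- by rewrite /P tau_linear !(hdotDr, hdotZr); ring.
rewrite /P IH ?prodE ?subrr // => i mi.
have [<-|ii0] := eqVneq i0 i; first by rewrite !dfwithin.
rewrite !dfwithout //; apply: xy; rewrite ltn_neqAle mi andbT.
by apply: contra ii0 => /eqP mi'; apply/eqP/val_inj.
Qed.

Section Density.
Variables (K : naLocalFieldType) (W : vectType K) (rho : W -> K -> H -> H).
Hypothesis rho_irr : irreducible_rep rho.
Hypothesis rho_unitary : forall w t, unitary_op (rho w t).
Hypothesis rho_tau : forall w t x, exists c x', rho w t (tau x) = c *: tau x'.
Hypothesis tau_neq0 : exists x, tau x != 0.

(* The closed span of the elementary tensors is an invariant subspace. *)
Lemma tensor_dense (z : H) (e : R) : 0 < e ->
  exists s : seq (R[i] * (forall i, Hi i)),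
    let z' := z - \sum_(p <- s) p.1 *: tau p.2 in hdot z' z' < e%:C%C.
Proof.
pose comb (s : seq (R[i] * (forall i, Hi i))) := \sum_(p <- s) p.1 *: tau p.2.
pose E := [set z : H | forall e : R, 0 < e -> exists s, norm2 (z - comb s) < e].
suff ET : E = setT.
  move=> e0; have : E z by rewrite ET.
  by move=> /(_ e e0)[s sP]; exists s; rewrite /= norm2_lt.
clear z e.
have combD s t : comb (s ++ t) = comb s + comb t by rewrite /comb big_cat.
have combZ s a : comb [seq (a * p.1, p.2) | p <- s] = a *: comb s.
  rewrite /comb big_map scaler_sumr.
  by apply: eq_bigr => p _; rewrite scalerA.
have E0 : E 0 by move=> e e0; exists [::]; rewrite /comb big_nil subr0 /norm2 hdot0l.
have tauE x : E (tau x).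
  move=> e' e0; exists [:: (1, x)].
  by rewrite /comb big_seq1 scale1r subrr /norm2 hdot0l.
have [] := rho_irr.2 E; last by [].
- split=> [//|a x y xE yE e e0|x xE e e0].
  + pose q := complex.Re (`|a| ^+ 2).
    have q0 : 0 <= q.
      by rewrite /q normc_def -rmorphXn /= sqr_sqrtr ?addr_ge0 ?sqr_ge0.
    (* [norm2D_le] doubles both terms, so each must stay within a quarter of [e]; [q + 1] replaces
       [q], which may be 0. *)
    have e1 : 0 < e / (4%:R * (q + 1)).
      by rewrite divr_gt0 // mulr_gt0 // ltr_wpDl.
    have e2 : 0 < e / 4%:R by rewrite divr_gt0.
    have [s sP] := xE _ e1; have [t tP] := yE _ e2.
    exists ([seq (a * p.1, p.2) | p <- s] ++ t).
    have -> : a *: x + y - comb ([seq (a * p.1, p.2) | p <- s] ++ t) =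
        a *: (x - comb s) + (y - comb t).
      by rewrite combD combZ scalerBr opprD addrACA.
    apply: le_lt_trans (norm2D_le _ _) _; rewrite norm2Z -/q.
    have : (q + 1) * norm2 (x - comb s) < e / 4%:R.
      have q1 : 0 < q + 1 by rewrite ltr_wpDl.
      move: sP; rewrite -(ltr_pM2l q1); congr (_ < _).
      by field; rewrite gt_eqF.
    have := norm2_ge0 (x - comb s); move: tP.
    move: (norm2 _) (norm2 _) => u v; nra.
  + have e2 : 0 < e / 4%:R by rewrite divr_gt0.
    have [y yE xy] := xE _ e2; have [s sP] := yE _ e2; exists s.
    rewrite -[x](subrK y) -addrA; apply: le_lt_trans (norm2D_le _ _) _.
    by move: xy; rewrite norm2_lt; lra.
- move=> w t x xE e e0; have [s sP] := xE _ e0.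
  have [c cP] := choice (rho_tau w t); have [g gP] := choice cP.
  exists [seq (p.1 * c p.2, g p.2) | p <- s].
  have [Ulin _ _] := rho_unitary w t.
  have U0 : rho w t 0 = 0.
    have := Ulin 1 0 0; rewrite scaler0 addr0 scale1r => /eqP.
    by rewrite -subr_eq0 opprD addrA subrr sub0r oppr_eq0 => /eqP.
  have UD y z' : rho w t (y + z') = rho w t y + rho w t z'.
    by rewrite -[y]scale1r Ulin !scale1r.
  have UZ a y : rho w t (a *: y) = a *: rho w t y.
    by rewrite -[a *: y]addr0 Ulin U0 addr0.
  have -> : comb [seq (p.1 * c p.2, g p.2) | p <- s] = rho w t (comb s).
    rewrite /comb (big_morph _ UD U0) big_map; apply: eq_bigr => p _ /=.
    by rewrite UZ gP scalerA.
  by rewrite -scaleN1r -UZ -UD scaleN1r (unitary_norm2 _ (rho_unitary w t)).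
move=> E1; have [x /negP[]] := tau_neq0; apply/eqP.
by have := tauE x; rewrite E1.
Qed.

End Density.
End Tensor.

(** * Orthogonal sums of lattices *)

Section LatticeSum.
Variables (k : naLocalFieldType) (W : vectType k) (beta : W -> W -> k) (n : nat).
Variables (U : 'I_n -> vectType k) (bi : forall i, U i -> U i -> k).
Variables (inj : forall i, 'Hom(U i, W)) (pr : forall i, 'Hom(W, U i)).
Arguments bi : clear implicits.
Hypothesis bi_sympl : forall i, symplectic_form (bi i).
Hypothesis W_sum : orthogonal_sum beta bi inj pr.
Variables (varpi : k) (lam : int).

Definition direct_sum_of (L : set W) (Li : forall i, set (U i)) :=
  forall w, L w <-> forall i, Li i (pr i w).

Lemma direct_sum_inj L Li i u : direct_sum_of L Li -> (forall j, Li j 0) ->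
  Li i u -> L (inj i u).
Proof.
case: W_sum => _ pi pij _ L_sum L0 Lu; apply/L_sum => j.
have [ij|ij] := eqVneq i j; last by rewrite pij.
by subst j; rewrite pi.
Qed.

Lemma form_pr i w u : beta w (inj i u) = bi i (pr i w) u.
Proof.
case: W_sum => _ pi pij ->; rewrite (bigD1 i) //= big1 ?addr0 ?pi // => j ji.
by rewrite [pr j (inj i u)]pij 1?eq_sym // (form0r (bi_sympl j)).
Qed.

Lemma dual_sum B Bi : direct_sum_of B Bi -> (forall i, Bi i 0) ->
  direct_sum_of (dual_lattice beta lam B)
    (fun i => dual_lattice (bi i) lam (Bi i)).
Proof.
move=> B_sum B0 w; split=> [wB i u uB|wB b /B_sum bB].
  by rewrite -form_pr; apply: wB; apply: direct_sum_inj uB.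
case: W_sum => _ _ _ ->; apply: pideal_sum => i _.
by apply: wB; apply: bB.
Qed.

(** Compactness is Tychonoff: in coordinates [A] is the image of the product of the [Ai] under the
    continuous sum map [Psi]. *)
Lemma lattice_sum A Ai : direct_sum_of A Ai -> (forall i, lattice (Ai i)) ->
  lattice A.
Proof.
move=> A_sum latA; split.
- by apply/A_sum => i; rewrite linear0; case: (latA i).
- move=> u v /A_sum uA /A_sum vA; apply/A_sum => i; rewrite linearD.
  by case: (latA i) => _ + _ _ _; apply.
- move=> a u aI /A_sum uA; apply/A_sum => i; rewrite linearZ.
  by case: (latA i) => _ _ + _ _; apply.
- rewrite vcoords_image openE => r /= /A_sum rA.
  have near_i i : \forall s \near r, Ai i (pr i (of_coords s)).
    have [_ _ _ + _] := latA i.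
    rewrite vcoords_image openE => /(_ (vcoords (pr i (of_coords r)))) /=.
    rewrite vcoordsK => /(_ (rA i)) nb.
    have near_c : \forall s \near r, Ai i (of_coords (vcoords (pr i (of_coords s)))).
      exact: (@continuous_lfun_coords _ _ _ (pr i) r _ nb).
    by apply: filterS near_c => s; rewrite vcoordsK.
  by apply: filterS (filter_forall _ near_i) => s sA; apply/A_sum.
pose T i : topologicalType := 'rV[k]_(\dim (@fullv k (U i))).
pose Psi (f : prod_topology T) : 'rV[k]_(\dim (@fullv k W)) :=
  vcoords (\sum_i inj i (of_coords (f i))).
have cPsi : continuous Psi.
  apply: continuous_rV => j.
  have -> : (fun f => Psi f 0 j) =
      fun f => \sum_i vcoords (inj i (of_coords (f i))) 0 j.
    apply/funext => f; rewrite mxE linear_sum.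
    by apply: eq_bigr => i _; rewrite mxE.
  apply: continuous_sumk => i f.
  apply: (@continuous_comp _ _ _ (fun g : prod_topology T => g i)
    (fun r => vcoords (inj i (of_coords r)) 0 j)).
    exact: (@proj_continuous _ T i f).
  apply: (@continuous_comp _ _ _ (fun r => vcoords (inj i (of_coords r)))
    (fun r : 'rV[k]_(\dim (@fullv k W)) => r 0 j)).
    exact: continuous_lfun_coords.
  exact: continuous_entry.
have cpt : compact (Psi @` [set f : prod_topology T | forall i,
    (@vcoords k (U i) @` Ai i) (f i)]).
  apply: continuous_compact; first exact: continuous_subspaceT.
  apply: (@tychonoff _ T (fun i => @vcoords k (U i) @` Ai i)) => i.
  by case: (latA i).
move: cpt; congr compact; apply/seteqP; split.
  move=> _ [f fA <-]; exists (\sum_i inj i (of_coords (f i))) => //.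
  apply/A_sum => i; rewrite (pr_sum W_sum (fun i => of_coords (f i))).
  by have [u uA <-] := fA i; rewrite vcoordsK.
move=> _ [w /A_sum wA <-]; exists (fun i => vcoords (pr i w)).
  by move=> i; exists (pr i w).
congr vcoords; case: W_sum => wE _ _ _; rewrite [RHS]wE.
by apply: eq_bigr => i _; rewrite vcoordsK.
Qed.

Lemma self_dual_sum A Ai : direct_sum_of A Ai ->
  (forall i, self_dual_lattice (bi i) lam (Ai i)) -> self_dual_lattice beta lam A.
Proof.
move=> A_sum sdA; split.
  by apply: (lattice_sum A_sum) => i; case: (sdA i).
have A0 i : Ai i 0 by case: (sdA i) => -[].
apply/seteqP; split=> w.
  move/A_sum => wA; apply/(dual_sum A_sum A0) => i.
  by have [_ <-] := sdA i.
move/(dual_sum A_sum A0) => wA; apply/A_sum => i.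
by have [_ ->] := sdA i.
Qed.

Section ReductionSum.
Hypothesis varpi_unif : uniformizer varpi.
Variables (B : set W) (Bi : forall i, set (U i)).
Arguments Bi : clear implicits.
Hypothesis B_sum : direct_sum_of B Bi.
Hypothesis Bi_good : forall i, good_lattice (bi i) varpi lam (Bi i).
Variables (r : reduction beta varpi lam B).
Variables (ri : forall i, reduction (bi i) varpi lam (Bi i)).

Let Bi0 i : Bi i 0. Proof. by case: (Bi_good i) => -[]. Qed.

Let beta_sympl : symplectic_form beta := orthogonal_sum_symplectic bi_sympl W_sum.

Lemma good_lattice_sum : good_lattice beta varpi lam B.
Proof.
split.
- by apply: (lattice_sum B_sum) => i; case: (Bi_good i).
- move=> _ [w /(dual_sum B_sum Bi0) wB <-]; apply/B_sum => i; rewrite linearZ.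
  by case: (Bi_good i) => _ + _; apply; exists (pr i w).
move=> w /B_sum wB; apply/(dual_sum B_sum Bi0) => i.
by case: (Bi_good i) => _ _; apply.
Qed.

(** The reductions are arbitrary records, so the maps between their spaces are defined through
    lifts. [injE] and [prE] show independence of the lift, and linearity follows. *)
Lemma reduction_sum :
  exists (rinj : forall i, 'Hom(red_space (ri i), red_space r))
         (rpr : forall i, 'Hom(red_space r, red_space (ri i))),
    [/\ orthogonal_sum (@red_form _ _ _ _ _ _ r)
          (fun i => @red_form _ _ _ _ _ _ (ri i)) rinj rpr,
        forall i u, dual_lattice (bi i) lam (Bi i) u ->
          rinj i (red_proj (ri i) u) = red_proj r (inj i u) &
        forall i w, dual_lattice beta lam B w ->
          rpr i (red_proj r w) = red_proj (ri i) (pr i w)].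
Proof.
have good_B := good_lattice_sum.
have BdS := dual_sum B_sum Bi0.
have [d0 dD dZ] := dual_submodule lam beta_sympl B.
have di i := dual_submodule lam (bi_sympl i) (Bi i).
have d_inj i u : dual_lattice (bi i) lam (Bi i) u ->
    dual_lattice beta lam B (inj i u).
  by apply: (direct_sum_inj BdS) => j; case: (di j).
pose lift (x : red_space r) := s2val (cid2 (red_proj_surj x)).
have liftB x : dual_lattice beta lam B (lift x) := s2valP (cid2 (red_proj_surj x)).
have liftK x : red_proj r (lift x) = x := s2valP' (cid2 (red_proj_surj x)).
pose lifti i (x : red_space (ri i)) := s2val (cid2 (red_proj_surj x)).
have liftiB i x : dual_lattice (bi i) lam (Bi i) (@lifti i x) :=
  s2valP (cid2 (red_proj_surj x)).
have liftiK i x : red_proj (ri i) (@lifti i x) = x :=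
  s2valP' (cid2 (red_proj_surj x)).
have injE i u : dual_lattice (bi i) lam (Bi i) u ->
    red_proj r (inj i (lifti i (red_proj (ri i) u))) = red_proj r (inj i u).
  move=> uB; apply/(red_proj_eq beta_sympl r good_B); try exact: d_inj.
  rewrite -linearB; apply: (direct_sum_inj B_sum) => //.
  by apply/(red_proj_eq (bi_sympl i) (ri i) (Bi_good i)); rewrite ?liftiK.
have prE i w : dual_lattice beta lam B w ->
    red_proj (ri i) (pr i (lift (red_proj r w))) = red_proj (ri i) (pr i w).
  move=> wB; have /BdS lB := liftB (red_proj r w); have /BdS wBi := wB.
  apply/(red_proj_eq (bi_sympl i) (ri i) (Bi_good i)) => //.
  rewrite -linearB; move: i; apply/B_sum.
  by apply/(red_proj_eq beta_sympl r good_B); rewrite ?liftK.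
have exinj i : exists f : 'Hom(red_space (ri i), red_space r),
    f =1 (fun x => red_proj r (inj i (lifti i x))).
  apply: linear_lfun => a x y; have [c c0 <-] := residue_lift a.
  have [_ diD diZ] := di i.
  rewrite -[x in LHS]liftiK -[y in LHS]liftiK -red_projZ // -red_projD //;
    last exact: diZ.
  rewrite injE; last by apply: diD => //; apply: diZ.
  rewrite linearD linearZ /= red_projD ?red_projZ //; try exact: d_inj.
  by apply: dZ => //; apply: d_inj.
have expr i : exists f : 'Hom(red_space r, red_space (ri i)),
    f =1 (fun x => red_proj (ri i) (pr i (lift x))).
  apply: linear_lfun => a x y; have [c c0 <-] := residue_lift a.
  have [_ _ diZ] := di i.
  have /BdS/(_ i) xB := liftB x; have /BdS/(_ i) yB := liftB y.
  rewrite -[x in LHS]liftK -[y in LHS]liftK -red_projZ // -red_projD //;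
    last exact: dZ.
  rewrite prE; last by apply: dD => //; apply: dZ.
  rewrite linearD linearZ /= red_projD ?red_projZ //.
  exact: diZ.
exists (fun i => sval (cid (exinj i))), (fun i => sval (cid (expr i))).
have injP i := svalP (cid (exinj i)); have prP i := svalP (cid (expr i)).
have inj_proj i u : dual_lattice (bi i) lam (Bi i) u ->
    sval (cid (exinj i)) (red_proj (ri i) u) = red_proj r (inj i u).
  by move=> uB; rewrite injP injE.
have pr_proj i w : dual_lattice beta lam B w ->
    sval (cid (expr i)) (red_proj r w) = red_proj (ri i) (pr i w).
  by move=> wB; rewrite prP prE.
split=> //; case: (W_sum) => wE pi pij bE; split.
- move=> v; have /BdS lB := liftB v.
  (* Membership in the dual lattice is carried through the induction because [red_proj] is additive
     only there; the same is done below for [residue] on the integers. *)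
  have : dual_lattice beta lam B (\sum_i inj i (pr i (lift v))) /\
      red_proj r (\sum_i inj i (pr i (lift v))) =
      \sum_i red_proj r (inj i (pr i (lift v))).
    apply: (big_ind2 (fun x y => dual_lattice beta lam B x /\ red_proj r x = y)).
    + by split=> //; exact: (red_proj0 beta_sympl r good_B).
    + by move=> x1 y1 x2 y2 [x1B <-] [x2B <-]; split; [exact: dD | exact: red_projD].
    by move=> i _; split=> //; apply: d_inj.
  rewrite -wE liftK => -[_ {1}->]; apply: eq_bigr => i _.
  by rewrite -{2}(liftK v) pr_proj // inj_proj.
- move=> i x; rewrite -(liftiK i x) inj_proj // pr_proj ?pi //.
  exact: d_inj.
- move=> i j x ij; rewrite -(liftiK i x) inj_proj // pr_proj ?pij //.
    exact: (red_proj0 (bi_sympl j) (ri j) (Bi_good j)).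
  exact: d_inj.
move=> v w; rewrite -(liftK v) -(liftK w).
have /BdS vB := liftB v; have /BdS wB := liftB w.
rewrite red_formE // bE mulr_sumr.
have : integers (\sum_i varpi ^ (1 - lam) *
      bi i (pr i (lift v)) (pr i (lift w))) /\
    residue (\sum_i varpi ^ (1 - lam) * bi i (pr i (lift v)) (pr i (lift w))) =
    \sum_i residue (varpi ^ (1 - lam) * bi i (pr i (lift v)) (pr i (lift w))).
  apply: (big_ind2 (fun x y => integers x /\ residue x = y)).
  + by split; [exact: pideal0 | exact: residue0].
  + move=> x1 y1 x2 y2 [x1B <-] [x2B <-]; split; first exact: pidealD.
    exact: residue_add.
  move=> i _; split=> //.
  exact: (dual_form_integers varpi_unif (bi_sympl i) (Bi_good i)).
case=> _ ->; apply: eq_bigr => i _.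
by rewrite !pr_proj // red_formE.
Qed.

End ReductionSum.
End LatticeSum.

(** * Factorization of the operators S^A *)

(** Here [w], [t i] and [s] stand for omega(1), omega of the theta of each component, and the square
    root of q. The [w] from [omega_prod] cancels the one from the 1 in the exponent, and each factor
    then recovers its own. *)
Lemma prod_constants (C : fieldType) n (w s : C) (t : 'I_n -> C)
    (j : 'I_n -> nat) : w != 0 ->
  (w * \prod_i (t i / w))^-1 * w ^ (1 - (\sum_i j i)%N%:Z) * s ^+ (\sum_i j i)%N =
  \prod_i ((t i)^-1 * w ^ (1 - (j i)%:Z) * s ^+ j i).
Proof.
move=> w0; have expj (m : nat) : w ^ (1 - m%:Z) = w * (w^-1) ^+ m.
  by rewrite expfzDr // expr1z -exprnN exprVn.
rewrite expj invfM -prodfV !expr_sum.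
have cancel_w P Q S : w^-1 * P * (w * Q) * S = P * Q * S :> C.
  by rewrite [w^-1 * P]mulrC -!mulrA mulKf.
rewrite cancel_w -!big_split; apply: eq_bigr => i _ /=.
by rewrite expj invf_div [w / _]mulrC !mulrA.
Qed.

Section Models.
Variables (R : realType) (k : naLocalFieldType).
Hypothesis odd_residue : 2%N \notin [pchar resf k].
Variables (varpi : k) (varpi_unif : uniformizer varpi).
Variables (psi : k -> R[i]) (lam : int).
Hypotheses (psi_char : unitary_character psi) (psi_cond : has_conductor psi lam).
Local Notation half := (2%:R^-1 : k).

Let psiM := psiD psi_char.

Lemma psi_half x : pideal lam x -> psi (half * x) = 1.
Proof.
case: psi_cond => psi1 _ xl; apply: psi1.
exact: integersZ (integers_half odd_residue) xl.
Qed.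

Section OneSpace.
Variables (W : vectType k) (beta : W -> W -> k).
Hypothesis beta_sympl : symplectic_form beta.
Variables (A : set W) (A_sd : self_dual_lattice beta lam A).

Definition quasi_periodic (f : W -> R[i]) :=
  forall a w, A a -> f (a + w) = psi (half * beta w a) * f w.

Lemma self_dual_subgroup : subgroup A.
Proof.
case: A_sd => latA _; have sA := lattice_submodule latA.
by split=> [|u v]; [case: sA | exact: submoduleB].
Qed.

Lemma self_dual_form u v : A u -> A v -> pideal lam (beta u v).
Proof. by case: A_sd => _ {1}->; apply. Qed.

Lemma stab_subgroup (g : 'End(W)) : subgroup (A `&` [set g a | a in A]).
Proof.
have [A0 AB] := self_dual_subgroup.
split; first by split=> //; exists 0 => //; rewrite linear0.
move=> u v [uA [a aA au]] [vA [c cA cv]]; split; first exact: AB.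
by exists (a - c); [exact: AB | rewrite linearB /= au cv].
Qed.

(** Quasi-periodicity produces a phase in which the terms in [beta d w] cancel; what remains is
    [psi (half * beta u d)], equal to 1 since [u] and [d] lie in the self-dual [A]. *)
Lemma SA_summand_invariant (g : 'End(W)) f w u d : Sp beta g -> quasi_periodic f ->
  A u -> (A `&` [set g a | a in A]) d ->
  psi (half * beta (u + d) w) * f (g^-1%VF (u + d + w)) =
  psi (half * beta u w) * f (g^-1%VF (u + w)).
Proof.
move=> gS qf uA [dA [a aA ad]]; have inj_g := Sp_inj beta_sympl gS.
have -> : g^-1%VF (u + d + w) = a + g^-1%VF (u + w).
  by rewrite addrAC [LHS]linearD /= -ad lker0_lfunK // [LHS]addrC.
rewrite qf // mulrA; congr (_ * _); rewrite -psiM -mulrDr.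
have -> : beta (g^-1%VF (u + w)) a = beta (u + w) d.
  by rewrite -gS lker0_lfunVK // ad.
rewrite !(formDl beta_sympl) [beta w d](formC beta_sympl).
have -> : beta u w + beta d w + (beta u d - beta d w) = beta u w + beta u d.
  by ring.
by rewrite mulrDr psiM (psi_half (self_dual_form uA dA)) mulr1.
Qed.

(** As [D] contains [B], these cosets are images of elements of the reduction of [B], a finite
    space. *)
Lemma finite_cosets (B D : set W) (r : reduction beta varpi lam B) :
  good_lattice beta varpi lam B -> subgroup D -> B `<=` D ->
  A `<=` dual_lattice beta lam B -> finite_set (cosets A D).
Proof.
move=> B_good sD BD AB.
pose lift (x : red_space r) := s2val (cid2 (red_proj_surj x)).
have liftB x : dual_lattice beta lam B (lift x) := s2valP (cid2 (red_proj_surj x)).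
have liftK x : red_proj r (lift x) = x := s2valP' (cid2 (red_proj_surj x)).
apply: sub_finite_set (finite_image (fun x => [set lift x + y | y in D])
  (finite_vspace (red_space r))).
move=> _ [u uA <-]; exists (red_proj r u) => //.
apply: coset_eq => //; apply: BD.
by apply/(red_proj_eq beta_sympl r B_good) => //; apply: AB.
Qed.

End OneSpace.

(** Written as a sum of ones, the index in [SA] factors by the same lemma as the sum itself. *)
Lemma fsum_card (I : choiceType) (Q : set I) : finite_set Q ->
  \sum_(c \in Q) (1 : R[i]) = (#|` fset_set Q|)%:R.
Proof.
by move=> finQ; rewrite fsbig_finite // big_const_seq count_predT iter_addr addr0.
Qed.

Section Sum.
Variables (W : vectType k) (beta : W -> W -> k) (n : nat).
Variables (U : 'I_n -> vectType k) (bi : forall i, U i -> U i -> k).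
Variables (inj : forall i, 'Hom(U i, W)) (pr : forall i, 'Hom(W, U i)).
Arguments bi : clear implicits.
Hypothesis bi_sympl : forall i, symplectic_form (bi i).
Hypothesis W_sum : orthogonal_sum beta bi inj pr.
Variables (B A : set W) (Bi Ai : forall i, set (U i)).
Arguments Bi : clear implicits.
Arguments Ai : clear implicits.
Hypotheses (B_sum : direct_sum_of pr B Bi) (A_sum : direct_sum_of pr A Ai).
Hypothesis Bi_good : forall i, good_lattice (bi i) varpi lam (Bi i).
Hypothesis Ai_sd : forall i, self_dual_lattice (bi i) lam (Ai i).
Hypothesis BAi : forall i, Bi i `<=` Ai i.
Hypothesis ABi : forall i, Ai i `<=` dual_lattice (bi i) lam (Bi i).
Variables (r : reduction beta varpi lam B).
Variables (ri : forall i, reduction (bi i) varpi lam (Bi i)).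
Variables (X : {vspace red_space r}) (theta : 'End(red_space r) -> resf k).
Variables (Xi : forall i, {vspace red_space (ri i)}).
Variables (thetai : forall i, 'End(red_space (ri i)) -> resf k).
Arguments thetai : clear implicits.
Hypothesis X_A : forall v, v \in X <-> exists2 a, A a & red_proj r a = v.
Hypothesis Xi_A : forall i v,
  v \in Xi i <-> exists2 a, Ai i a & red_proj (ri i) a = v.
Hypothesis theta_th : is_theta (@red_form _ _ _ _ _ _ r) X theta.
Hypothesis thetai_th :
  forall i, is_theta (@red_form _ _ _ _ _ _ (ri i)) (Xi i) (thetai i).
Variables (g : 'End(W)) (gi : forall i, 'End(U i)).
Hypothesis g_sum : forall i w, pr i (g w) = gi i (pr i w).
Hypothesis gi_stab : forall i, stabilizer (bi i) (Bi i) (gi i).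

Let beta_sympl : symplectic_form beta := orthogonal_sum_symplectic bi_sympl W_sum.
Let B_good : good_lattice beta varpi lam B :=
  good_lattice_sum bi_sympl W_sum B_sum Bi_good.
Let A_sd : self_dual_lattice beta lam A := self_dual_sum bi_sympl W_sum A_sum Ai_sd.
Let Bi0 i : Bi i 0. Proof. by case: (Bi_good i) => -[]. Qed.

Lemma image_sum L Li : direct_sum_of pr L Li ->
  direct_sum_of pr [set g a | a in L] (fun i => [set gi i a | a in Li i]).
Proof.
move=> L_sum w; split=> [[a /L_sum aL <-] i|wL].
  by rewrite g_sum; exists (pr i a).
pose a i := s2val (cid2 (wL i)).
exists (\sum_i inj i (a i)).
  apply/L_sum => i; rewrite (pr_sum W_sum a); exact: s2valP (cid2 (wL i)).
apply: (orthogonal_sumP W_sum) => i; rewrite g_sum (pr_sum W_sum a).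
exact: s2valP' (cid2 (wL i)).
Qed.

Lemma stabilizer_sum : stabilizer beta B g.
Proof.
split.
  move=> v w; case: W_sum => _ _ _ bE; rewrite !bE; apply: eq_bigr => i _.
  by rewrite !g_sum; case: (gi_stab i).
apply/seteqP; split=> w.
  move/(image_sum B_sum) => wB; apply/B_sum => i.
  by have := wB i; case: (gi_stab i) => _ ->.
move=> /B_sum wB; apply/(image_sum B_sum) => i.
by case: (gi_stab i) => _ ->.
Qed.

(** What must be checked is that, in the decomposed reduction, [X] is the sum of the [Xi i] and the
    reduction of [g] acts on each summand as that of [gi i]. *)
Lemma theta_jdim_reduction :
  eq_mod_squares (theta (red_end r g)) (\prod_i thetai i (red_end (ri i) (gi i))) /\
  jdim X (red_end r g) = (\sum_i jdim (Xi i) (red_end (ri i) (gi i)))%N.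
Proof.
have BdS := dual_sum bi_sympl W_sum lam B_sum Bi0.
have [rinj [rpr [r_sum injE prE]]] :=
  reduction_sum bi_sympl W_sum varpi_unif B_sum Bi_good r ri.
have form_i i := red_form_symplectic varpi_unif (bi_sympl i) (ri i) (Bi_good i).
apply: (theta_jdim_sum form_i r_sum (two_resf_neq0 odd_residue)) => //.
- move=> v; split=> [/X_A[a aA <-] i|vX].
    have aB : dual_lattice beta lam B a.
      by apply/BdS => j; apply: ABi; move/A_sum: aA.
    by rewrite prE //; apply/Xi_A; exists (pr i a) => //; move/A_sum: aA.
  pose P i := (Xi_A (rpr i v)).1 (vX i).
  pose a i := s2val (cid2 (P i)).
  have aA i : Ai i (a i) := s2valP (cid2 (P i)).
  have aE i : red_proj (ri i) (a i) = rpr i v := s2valP' (cid2 (P i)).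
  have sA : A (\sum_i inj i (a i)).
    by apply/A_sum => i; rewrite (pr_sum W_sum a).
  apply/X_A; exists (\sum_i inj i (a i)) => //.
  apply: (orthogonal_sumP r_sum) => i; rewrite prE.
    by rewrite (pr_sum W_sum a) aE.
  by apply/BdS => j; apply: ABi; rewrite (pr_sum W_sum a).
- move=> i v; have [u uB <-] := red_proj_surj v.
  have iuB : dual_lattice beta lam B (inj i u).
    apply: (direct_sum_inj W_sum BdS) => // j.
    by case: (dual_submodule lam (bi_sympl j) (Bi j)).
  rewrite injE // !red_endE //; last exact: stabilizer_sum.
  rewrite injE; last exact: stabilizer_dual.
  congr red_proj; apply: (orthogonal_sumP W_sum) => j; rewrite g_sum.
  case: W_sum => _ pi pij _; have [ij|ij] := eqVneq i j.
    by subst j; rewrite !pi.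
  by rewrite !pij // linear0.
- move=> i; exact: (red_lagrangian varpi_unif (bi_sympl i) (Bi_good i) (Ai_sd i)
    (@ABi i) (@Xi_A i)).
by move=> i; apply: red_end_Sp.
Qed.

Lemma mfactor_sum :
  mfactor psi X theta (red_end r g) * sqrtq R k ^+ jdim X (red_end r g) =
  \prod_i (mfactor psi (Xi i) (thetai i) (red_end (ri i) (gi i)) *
           sqrtq R k ^+ jdim (Xi i) (red_end (ri i) (gi i))).
Proof.
have [theta_g jdim_g] := theta_jdim_reduction.
have om0 := omega1_neq0 odd_residue varpi_unif psi_char psi_cond.
rewrite /mfactor (omega_eq_mod_squares _ _ _ theta_g).
rewrite (omega_prod odd_residue varpi_unif psi_char psi_cond); last first.
  move=> i; have [theta0 _ _ _] := thetai_th i; apply: theta0.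
  exact: red_end_Sp.
by rewrite jdim_g; apply: prod_constants.
Qed.

Lemma SA_sum (f : forall i, U i -> R[i]) w :
  (forall i, quasi_periodic (bi i) (Ai i) (f i)) ->
  SA psi A X theta g (fun w' => \prod_i f i (pr i w')) w =
  \prod_i SA psi (Ai i) (Xi i) (thetai i) (gi i) (f i) (pr i w).
Proof.
move=> qf; rewrite /SA.
pose D := A `&` [set g a | a in A].
pose Di i := Ai i `&` [set gi i a | a in Ai i].
have D_sum v : D v <-> forall i, Di i (pr i v).
  split=> [[/A_sum vA /(image_sum A_sum) vg] i|vD]; first by split.
  split; first by apply/A_sum => i; case: (vD i).
  by apply/(image_sum A_sum) => i; case: (vD i).
have sDi i : subgroup (Di i) := stab_subgroup (Ai_sd i) (gi i).
have AiD i u d : Ai i u -> Di i d -> Ai i (u + d).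
  move=> uA [dA _]; exact: subgroupD (self_dual_subgroup (Ai_sd i)) uA dA.
have BDi i : Bi i `<=` Di i.
  move=> b bB; split; first exact: BAi.
  case: (gi_stab i) => _ gB; move: bB; rewrite -gB => -[c cB <-].
  by exists c => //; apply: BAi.
have finDi i : finite_set (cosets (Ai i) (Di i)).
  exact: (finite_cosets (bi_sympl i) (ri i) (Bi_good i) (sDi i) (@BDi i) (@ABi i)).
have finD : finite_set (cosets A D).
  apply: (finite_cosets beta_sympl r B_good (stab_subgroup A_sd g)).
    by move=> b /B_sum bB; apply/D_sum => i; apply: BDi.
  move=> a /A_sum aA; apply/(dual_sum bi_sympl W_sum lam B_sum Bi0) => i.
  exact: ABi.
have gS : Sp beta g by case: stabilizer_sum.
have giS i : Sp (bi i) (gi i) by case: (gi_stab i).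
have prV i v : pr i (g^-1%VF v) = (gi i)^-1%VF (pr i v).
  have inj_gi := Sp_inj (bi_sympl i) (giS i); have inj_g := Sp_inj beta_sympl gS.
  move/lker0P: (inj_gi) => gi_inj; apply: gi_inj.
  by rewrite (lker0_lfunVK inj_gi) -g_sum (lker0_lfunVK inj_g).
have cardE : (#|` fset_set (cosets A D)|)%:R =
    \prod_i (#|` fset_set (cosets (Ai i) (Di i))|)%:R :> R[i].
  rewrite -(fsum_card finD); under eq_bigr do rewrite -(fsum_card (finDi _)).
  rewrite -(coset_fsum W_sum A_sum D_sum sDi AiD (g := fun _ _ => 1)) //.
  by apply: eq_fsbigr => c _; rewrite big1.
(* The summand of [SA] is a product of such terms: [beta] is a sum over the components and [psi]
   turns it into a product. *)
pose G i u := psi (half * bi i u (pr i w)) * f i ((gi i)^-1%VF (u + pr i w)).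
have sumE : \sum_(c \in cosets A D) (psi (half * beta (xget 0 c) w) *
      \prod_i f i (pr i (g^-1%VF (xget 0 c + w)))) =
    \prod_i \sum_(c \in cosets (Ai i) (Di i)) G i (xget 0 c).
  rewrite -(coset_fsum W_sum A_sum D_sum sDi AiD) //; last first.
    move=> i u d uA dD.
    exact: (SA_summand_invariant (bi_sympl i) (Ai_sd i) _ (giS i) (qf i) uA dD).
  apply: eq_fsbigr => c _; case: (W_sum) => _ _ _ ->.
  rewrite mulr_sumr (psi_sum psi_char psi_cond) -big_split.
  by apply: eq_bigr => i _; rewrite prV linearD.
rewrite mfactor_sum cardE sumE -prodfV -!big_split.
by apply: eq_bigr.
Qed.

Lemma Re_norm2 (z : R[i]) : (complex.Re (`|z| ^+ 2))%:C%C = `|z| ^+ 2.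
Proof. by rewrite normc_def -rmorphXn. Qed.

(** Since [psi] has absolute value 1, the squared modulus of each [f i] is invariant under [Ai i],
    as the product formula for coset sums requires. *)
Lemma l2norm2_sum (f : forall i, U i -> R[i]) (s : 'I_n -> R) :
  (forall i, quasi_periodic (bi i) (Ai i) (f i)) ->
  (forall i, l2norm2 (Ai i) (f i) = (s i)%:E) ->
  l2norm2 A (fun w => \prod_i f i (pr i w)) = (\prod_i s i)%:E.
Proof.
move=> qf fs; rewrite -(@coset_esum _ _ _ _ _ _ _ _ W_sum setT A (fun=> setT) Ai _
  A_sum _ _ R (fun i u => complex.Re (`|f i u| ^+ 2)) s) //.
- apply: eq_esum => c _; congr (_%:E); rewrite normr_prod -prodrXl.
  under eq_bigr => i _ do rewrite -Re_norm2.
  by rewrite -rmorph_prod.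
- by move=> i; exact: (self_dual_subgroup (Ai_sd i)).
- by move=> i u; have := exprn_ge0 2 (normr_ge0 (f i u)); rewrite -Re_norm2 lecR.
move=> i u d _ dA; rewrite addrC qf // normrM.
by case: psi_char => _ -> _; rewrite mul1r.
Qed.

Lemma quasi_periodic_sum (f : forall i, U i -> R[i]) :
  (forall i, quasi_periodic (bi i) (Ai i) (f i)) ->
  quasi_periodic beta A (fun w => \prod_i f i (pr i w)).
Proof.
move=> qf a w /A_sum aA; case: (W_sum) => _ _ _ ->.
rewrite mulr_sumr (psi_sum psi_char psi_cond) -big_split.
by apply: eq_bigr => i _; rewrite linearD qf.
Qed.

End Sum.
End Models.

(** * The given decomposition of W, and the theorem *)

Section Decomposition.
Variables (K : fieldType) (W : vectType K) (beta : W -> W -> K).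
Hypothesis beta_sympl : symplectic_form beta.
Variables (T : set 'End(W)) (n : nat) (Wi : 'I_n -> {vspace W}).
Hypothesis Wi_dec : irreducible_decomposition beta T Wi.

Lemma decomposition_sum : exists pr : forall i, 'Hom(W, subvs_of (Wi i)),
  orthogonal_sum beta (fun i => restr_form beta (Wi i))
    (fun i => linfun (@vsval _ _ (Wi i))) pr.
Proof.
case: Wi_dec => sumW directW orthW _ _.
pose pi i w := sumv_pi_for (esym sumW) i w.
have pi_mem i w : pi i w \in Wi i by apply: memv_sum_pi.
have ex_pr i : exists f : 'Hom(W, subvs_of (Wi i)),
    f =1 fun w => vsproj (Wi i) (pi i w).
  by apply: linear_lfun => a u v; rewrite /pi !linearP.
pose pr i := sval (cid (ex_pr i)).
have prE i w : vsval (pr i w) = pi i w.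
  by rewrite /pr (svalP (cid (ex_pr i))) vsprojK.
have wE w : w = \sum_i vsval (pr i w).
  by under eq_bigr do rewrite prE; rewrite /pi sumv_pi_sum ?memvf.
have pr_vsval i j (u : subvs_of (Wi i)) :
    vsval (pr j (vsval u)) = if j == i then vsval u else 0.
  have := directv_sum_unique directW.
  move=> /(_ (fun j => vsval (pr j (vsval u)))
             (fun j => if j == i then vsval u else 0)).
  rewrite -wE -big_mkcond big_pred1_eq eqxx => /(_ _ _)/esym/forall_inP uE.
  apply/eqP/uE => // m _; first exact: subvsP.
  by case: eqP => [->|_]; [exact: subvsP | exact: mem0v].
exists pr; split.
- by move=> w; rewrite {1}(wE w); apply: eq_bigr => i _; rewrite lfunE.
- by move=> i u; apply: val_inj; rewrite lfunE /= -[LHS]/(vsval _) pr_vsval eqxx.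
- move=> i j u ij; apply: val_inj; rewrite lfunE /= -[LHS]/(vsval _) pr_vsval.
  by rewrite eq_sym (negPf ij).
move=> v w; rewrite {1}(wE v) {1}(wE w) (form_suml beta_sympl).
apply: eq_bigr => i _; rewrite (form_sumr beta_sympl) (bigD1 i) //= big1 ?addr0 //.
by move=> j ji; apply: orthW (subvsP _) (subvsP _); rewrite eq_sym.
Qed.

Lemma restr_endE (V : {vspace W}) (g : 'End(W)) u :
  stable_sub V g -> vsval (restr_end V g u) = g (vsval u).
Proof.
move=> gV; rewrite /restr_end.
have lin : linear (fun u : subvs_of V => vsproj V (g (vsval u))).
  by move=> a x y; rewrite !linearP.
rewrite (linfunE lin) vsprojK //.
by apply: (subvP gV); apply/memv_img/subvsP.
Qed.

End Decomposition.

Section ModelIso.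
Variables (R : realType) (k : naLocalFieldType) (psi : k -> R[i]).
Variables (W : vectType k) (beta : W -> W -> k) (A : set W) (H : hilbert R).
Variables (rho : W -> k -> H -> H) (Phi : H -> W -> R[i]).
Hypothesis Phi_iso : model_iso psi beta A rho Phi.

Lemma model_norm2 x : l2norm2 A (Phi x) = (norm2 x)%:E.
Proof. by case: Phi_iso => _ _ <-. Qed.

(** [Phi] is linear and preserves norms. Identities in [H] can therefore be verified on functions on
    [W]. *)
Lemma model_inj : injective Phi.
Proof.
case: Phi_iso => Phi_lin _ _ _.
have Phi0 w : Phi 0 w = 0.
  have /eqP := Phi_lin 1 0 0 w; rewrite scaler0 addr0 mul1r -subr_eq0.
  by rewrite opprD addrA subrr sub0r oppr_eq0 => /eqP.
move=> x y xy; apply/eqP; rewrite -subr_eq0; apply/eqP/norm2_eq0.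
have Phixy : Phi (x - y) = Phi 0.
  apply/funext => w; rewrite addrC -scaleN1r Phi_lin xy Phi0.
  by rewrite mulN1r addNr.
by apply: EFin_inj; rewrite -model_norm2 Phixy model_norm2 /norm2 hdot0l.
Qed.

End ModelIso.

Theorem proposition6p2p1
  (R : realType)
  (k : naLocalFieldType) (char0 : [pchar k] =i pred0)
  (odd_residue : 2%N \notin [pchar resf k])
  (varpi : k) (varpi_unif : uniformizer varpi)
  (psi : k -> R[i]) (lam : int)
  (psi_char : unitary_character psi) (psi_cond : has_conductor psi lam)
  (W : vectType k) (W_neq0 : @fullv k W != 0%VS)
  (beta : W -> W -> k) (beta_sympl : symplectic_form beta)
  (T : set 'End(W)) (T_elliptic : maximal_elliptic_torus beta T)
  (n : nat) (Wi : 'I_n -> {vspace W})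
  (Wi_dec : irreducible_decomposition beta T Wi)
  (Bi : forall i, set (subvs_of (Wi i)))
  (Bi_good : forall i, good_lattice (restr_form beta (Wi i)) varpi lam (Bi i))
  (Bi_inv : forall i t, T t -> [set restr_end (Wi i) t b | b in Bi i] = Bi i)
  (H : hilbert R) (rho : W -> k -> H -> H) (rho_psi : is_rho_psi psi beta rho)
  (Mp : set ('End(W) * (H -> H))) (Mp_def : metaplectic beta rho Mp)
  (sB : 'End(W) -> 'End(W) * (H -> H))
  (sB_def : is_section varpi psi lam beta (sum_lattice Bi) rho Mp sB)
  (Hi : 'I_n -> hilbert R)
  (rhoi : forall i, subvs_of (Wi i) -> k -> Hi i -> Hi i)
  (rhoi_psi : forall i, is_rho_psi psi (restr_form beta (Wi i)) (rhoi i))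
  (Mpi : forall i, set ('End(subvs_of (Wi i)) * (Hi i -> Hi i)))
  (Mpi_def : forall i, metaplectic (restr_form beta (Wi i)) (rhoi i) (Mpi i))
  (sBi : forall i, 'End(subvs_of (Wi i)) ->
                   'End(subvs_of (Wi i)) * (Hi i -> Hi i))
  (sBi_def : forall i, is_section varpi psi lam (restr_form beta (Wi i))
                         (Bi i) (rhoi i) (Mpi i) (sBi i)) :
  exists tau : (forall i, Hi i) -> H,
    hilbert_tensor tau /\
    forall t, T t -> forall x : (forall i, Hi i),
      weil (sB t) (tau x) =
      tau (fun i => weil (sBi i (restr_end (Wi i) t)) (x i)).
Proof.
have [[[TSp _ _ _ _] _] _] := T_elliptic.
have [pr W_sum] := decomposition_sum beta_sympl Wi_dec.
have [_ _ _ bi_sympl Wi_irr] := Wi_dec.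
pose inj i : 'Hom(subvs_of (Wi i), W) := linfun (@vsval _ _ (Wi i)).
have sumP (Li : forall i, set (subvs_of (Wi i))) :
    direct_sum_of pr (sum_lattice Li) Li.
  move=> w; split=> [[b bL ->] i|wL].
    have -> : \sum_i vsval (b i) = \sum_i inj i (b i).
      by apply: eq_bigr => j _; rewrite lfunE.
    by rewrite (pr_sum W_sum).
  exists (fun i => pr i w) => //; case: W_sum => wE _ _ _; rewrite {1}(wE w).
  by apply: eq_bigr => i _; rewrite lfunE.
have stabT t i : T t -> stable_sub (Wi i) t by move=> Tt; have [_ ->] := Wi_irr i.
have gi_stab t i : T t ->
    stabilizer (restr_form beta (Wi i)) (Bi i) (restr_end (Wi i) t).
  move=> Tt; split; last exact: Bi_inv.
  move=> u v; rewrite /restr_form !restr_endE; try exact: stabT.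
  exact: TSp.
have g_sum t i w : T t -> pr i (t w) = restr_end (Wi i) t (pr i w).
  move=> Tt; have -> : t w = \sum_j inj j (restr_end (Wi j) t (pr j w)).
    case: W_sum => wE _ _ _; rewrite {1}(wE w) linear_sum; apply: eq_bigr => j _.
    by rewrite /= !lfunE /= restr_endE //; apply: stabT.
  exact: (pr_sum W_sum (fun j => restr_end (Wi j) t (pr j w))).
(* The reduction comes first: in [is_section] it does not depend on the self-dual lattice, and here
   it is used to construct that lattice. *)
pose ci i := cid (sBi_def i).2; pose ri i := sval (ci i).
have [sB_Mp [r rP]] := sB_def.
have Bi0 i : Bi i 0 by case: (Bi_good i) => -[].
have exA i := self_dual_exists varpi_unif (bi_sympl i) (ri i) (Bi_good i).
pose Ai i := sval (cid (exA i)).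
have Ai_sd i : self_dual_lattice (restr_form beta (Wi i)) lam (Ai i).
  by case: (svalP (cid (exA i))).
have BAi i : Bi i `<=` Ai i by case: (svalP (cid (exA i))).
have ABi i : Ai i `<=` dual_lattice (restr_form beta (Wi i)) lam (Bi i).
  by case: (svalP (cid (exA i))).
pose A := sum_lattice Ai.
have BdS := dual_sum bi_sympl W_sum lam (sumP Bi) Bi0.
have A_sd : self_dual_lattice beta lam A.
  exact: (self_dual_sum bi_sympl W_sum (sumP Ai) Ai_sd).
have BA : sum_lattice Bi `<=` A.
  by move=> w /sumP wB; apply/sumP => i; apply: BAi.
have AB : A `<=` dual_lattice beta lam (sum_lattice Bi).
  by move=> w /sumP wA; apply/BdS => i; apply: ABi.
(* The descriptions of [sB] and of each [sBi] are now specialized to the chosen lattices. *)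
have [X [theta [Phi [X_A theta_th Phi_iso PhiS]]]] := rP A A_sd BA AB.
have exi i := svalP (ci i) (Ai i) (Ai_sd i) (BAi i) (ABi i).
pose c1 i := cid (exi i); pose c2 i := cid (svalP (c1 i)).
pose c3 i := cid (svalP (c2 i)).
pose Xi i := sval (c1 i); pose thetai i := sval (c2 i); pose Phii i := sval (c3 i).
have Xi_A i : forall v, v \in Xi i <-> exists2 a, Ai i a & red_proj (ri i) a = v.
  by case: (svalP (c3 i)).
have thetai_th i : is_theta (@red_form _ _ _ _ _ _ (ri i)) (Xi i) (thetai i).
  by case: (svalP (c3 i)).
have Phii_iso i : model_iso psi (restr_form beta (Wi i)) (Ai i) (rhoi i) (Phii i).
  by case: (svalP (c3 i)).
have PhiiS i g : stabilizer (restr_form beta (Wi i)) (Bi i) g -> forall x,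
    Phii i ((sBi i g).2 x) = SA psi (Ai i) (Xi i) (thetai i) g (Phii i x).
  by case: (svalP (c3 i)) => _ _ _; apply.
have qp i x : quasi_periodic psi (restr_form beta (Wi i)) (Ai i) (Phii i x).
  have : HA psi (restr_form beta (Wi i)) (Ai i) (Phii i x).
    by have [_ <- _ _] := Phii_iso i; exists x.
  by case.
pose prodPhi (x : forall i, Hi i) w := \prod_i Phii i (x i) (pr i w).
have prod_norm x : l2norm2 A (prodPhi x) = (\prod_i norm2 (x i))%:E.
  apply: (l2norm2_sum (f := fun i => Phii i (x i)) psi_char W_sum (sumP Ai) Ai_sd).
    by move=> i; apply: qp.
  by move=> i; apply: (model_norm2 (Phii_iso i)).
have ex_tau x : exists z, Phi z = prodPhi x.
  have : HA psi beta A (prodPhi x).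
    split; last by rewrite prod_norm ltry.
    apply: (quasi_periodic_sum (f := fun i => Phii i (x i)) psi_char psi_cond W_sum
      (sumP Ai)) => i.
    exact: qp.
  by have [_ <- _ _] := Phi_iso; case=> z _; exists z.
pose tau x := sval (cid (ex_tau x)).
have tauE x : Phi (tau x) = prodPhi x := svalP (cid (ex_tau x)).
have Phi_inj := model_inj Phi_iso.
have [Phi_lin _ _ Phi_rho] := Phi_iso.
have tau_lin (x : forall i, Hi i) i (a : R[i]) (u v : Hi i) :
  tau (dfwith x i (a *: u + v)) = a *: tau (dfwith x i u) + tau (dfwith x i v).
  apply: Phi_inj; apply/funext => w; rewrite Phi_lin !tauE /prodPhi.
  rewrite (bigD1 i) // [in RHS](bigD1 i) // [X in _ = _ + X](bigD1 i) //=.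
  rewrite !dfwithin; have [Phii_lin _ _ _] := Phii_iso i; rewrite Phii_lin.
  have outE z : \prod_(j < n | j != i) Phii j (dfwith x i z j) (pr j w) =
      \prod_(j < n | j != i) Phii j (x j) (pr j w).
    by apply: eq_bigr => j ji; rewrite dfwithout // eq_sym.
  by rewrite !outE mulrDl mulrA.
have tau_norm x : hdot (tau x) (tau x) = \prod_i hdot (x i) (x i).
  rewrite norm2E; under eq_bigr do rewrite norm2E.
  rewrite -rmorph_prod; congr (_%:C)%C; apply: EFin_inj.
  by rewrite -(model_norm2 Phi_iso) tauE prod_norm.
have [[rho_un _ _ _] rho_irr rho_psi0] := rho_psi.
have tau_rho w s x : exists c x', rho w s (tau x) = c *: tau x'.
  (* Only the component of [w] in each summand acts on its factor; the centre acts by [psi s], kept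
     as the scalar. *)
  exists (psi s), (fun i => rhoi i (pr i w) 0 (x i)); apply: Phi_inj.
  apply/funext => w'; rewrite Phi_rho tauE.
  have PhiZ a z v : Phi (a *: z) v = a * Phi z v.
    have Phi0 : Phi 0 v = 0.
      have /eqP := Phi_lin 1 0 0 v; rewrite scaler0 addr0 mul1r -subr_eq0.
      by rewrite opprD addrA subrr sub0r oppr_eq0 => /eqP.
    by rewrite -[a *: z]addr0 Phi_lin Phi0 addr0.
  rewrite PhiZ tauE /rhoA (psiD psi_char) -mulrA; congr (_ * _).
  case: (W_sum) => _ _ _ ->; rewrite mulr_sumr (psi_sum psi_char psi_cond).
  rewrite -big_split; apply: eq_bigr => i _ /=.
  by have [_ _ _ ->] := Phii_iso i; rewrite /rhoA add0r linearD.
exists tau; split; first split=> //.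
- exact: tensor_hdot.
- have nz i : exists x : Hi i, x != 0 by have [_ [+ _] _] := rhoi_psi i.
  apply: (tensor_dense rho_irr rho_un tau_rho).
  (* A tensor of non-zero vectors is non-zero: its squared norm is a product of non-zero factors. *)
  exists (fun i => sval (cid (nz i))); apply/eqP => tau0.
  have := tau_norm (fun i => sval (cid (nz i))); rewrite tau0 hdot0l.
  move/esym/eqP/prodf_eq0 => [i _ /eqP/hdot_eq0 xi0].
  by have := svalP (cid (nz i)); rewrite xi0 eqxx.
move=> t Tt x; apply: Phi_inj; rewrite /weil.
have t_sum i w : pr i (t w) = restr_end (Wi i) t (pr i w) by apply: g_sum.
have t_stab i := gi_stab t i Tt.
have B_stab := stabilizer_sum W_sum (sumP Bi) t_sum t_stab.
rewrite PhiS // !tauE; apply/funext => w.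
rewrite /prodPhi (SA_sum odd_residue varpi_unif psi_char psi_cond bi_sympl W_sum
  (sumP Bi) (sumP Ai) Bi_good Ai_sd BAi ABi X_A Xi_A theta_th thetai_th
  t_sum t_stab (f := fun i => Phii i (x i))) => [|i]; last exact: qp.
by apply: eq_bigr => i _; rewrite PhiiS.
Qed.
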